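(* For every (closed) convex polygon $C$ in the plane there is a constant $c$, depending only on $C$, such that the family of all homothets of $C$ is self-coverable with a self-coverability function $f$ satisfying $f(k)\le ck$ for all integers $k\ge 1$.
   Context: A homothet of a planar set $C$ is a set of the form $\lambda C+v$ with $\lambda>0$ and $v\in\mathbb R^2$. Polygons are closed regions. A collection of closed sets $\mathcal S$ is self-coverable if there exists a function $f$ from the non-negative integers to the non-negative integers (a self-coverability function of $\mathcal S$) such that for any $S\in\mathcal S$ and any finite point set $P\subset S$ with $|P|=k$ there exists a subcollection $\mathcal S'\subset\mathcal S$ with $|\mathcal S'|\le f(k)$ such that $\bigcup\mathcal S'=S$ and no point of $P$ is in the interior of any $S'\in\mathcal S'$. *)

(* Defs.v *)
From HB Require Import structures.
From mathcomp Require Import all_boot all_order all_algebra.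
From mathcomp Require Import all_classical all_reals all_analysis.

Set Implicit Arguments.
Unset Strict Implicit.
Unset Printing Implicit Defensive.

Import Order.TTheory GRing.Theory Num.Theory.
Import numFieldNormedType.Exports.

Local Open Scope classical_set_scope.
Local Open Scope card_scope.
Local Open Scope ring_scope.

Definition convex_hull (R : realType) (V : lmodType R) (A : set V) : set V :=
  smallest [set K : set V | convex_set K] A.

(* A polygon is the closed region, not its boundary curve. Nonempty interior
   rules out the degenerate hulls (empty set, point, segment). *)
Definition convex_polygon (R : realType) (C : set 'rV[R]_2) : Prop :=
  (exists2 V : set 'rV[R]_2, finite_set V & C = convex_hull V) /\
  C° !=set0.

Definition homothets (R : realType) (V : lmodType R) (C : set V) :
    set (set V) :=
  [set S | exists (lambda : R) (v : V),
     0 < lambda /\ S = [set lambda *: x + v | x in C]].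

(* [self_coverability_function F f]: F is a self-coverable collection of closed
   sets, as witnessed by f. *)
Definition self_coverability_function (T : topologicalType)
    (F : set (set T)) (f : nat -> nat) : Prop :=
  (forall S, F S -> closed S) /\
  forall (S : set T) (P : set T) (k : nat),
    F S -> P `<=` S -> P #= `I_k ->
    exists F' : set (set T),
      [/\ F' `<=` F,
          F' #<= `I_(f k),
          \bigcup_(A in F') A = S &
          forall p A, P p -> F' A -> ~ A° p].

(* Main.v *)
(* Write C as a translate of the unit ball {y | u_m . y <= 1 for all m} of a
   polyhedral gauge; its homothets are the balls B(v, l), and we may assume that
   S is the unit ball. Call a ball inside S empty if its interior contains no
   point of P. Adding O(|P|) sites on the lines bounding S, we may assume that an
   empty ball touching a wall and another obstacle touches a site on that wall.

   Given x in S, take a largest empty ball containing x. Being unable to grow, it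
   is blocked either along three edges, or at a vertex, or along two disjoint
   edges i and j. In the last case slide it in both directions, keeping the edges
   i and j on their lines, until it is blocked again: the two final positions
   cover the original one, because both contain the two blocking sites. So S is
   covered by empty balls with a site at a vertex and empty balls with sites on
   three edges. A ball of the first kind lies in the largest empty ball with that
   site at that vertex, and there are O(|P|) of these. A ball of the second kind
   is charged to the middle one of its three sites with respect to a linear
   functional that is injective on the sites. Two balls with the same three edges
   and the same middle site coincide: otherwise the triangles spanned by their
   sites would overlap near the middle site, whereas triangles inscribed in two
   homothets and avoiding the interior of the other one do not overlap. *)
Require Import Defs.
From mathcomp Require Import all_boot all_order all_algebra.
From mathcomp Require Import all_classical all_reals all_analysis.
From mathcomp Require Import ring lra.
Import Order.TTheory GRing.Theory Num.Theory.
Import numFieldNormedType.Exports.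
Local Open Scope classical_set_scope.
Local Open Scope ring_scope.

Set Implicit Arguments.
Unset Strict Implicit.
Unset Printing Implicit Defensive.

(** * Two homothets with a common site on a common edge *)

(* With the common site at the origin and the common edge along an axis, the
   [m]-th constraint [al * y + ro * x <= a] of a ball becomes [<= mu * a + x] for
   the other ball; primes refer to a second constraint and to a second point.
   Here [a] is scaled to 1. *)
Lemma noncrossing_unit (R : realFieldType) (mu al al' ro ro' x y x' y' : R) :
  1 <= mu -> 0 < al -> 0 < al' -> 0 < ro -> 0 < ro' ->
  0 < mu + x ->
  mu + x <= al * y + ro * x <= 1 -> al' * y - ro' * x <= mu + x ->
  1 <= al' * y' - ro' * x' <= mu + x' -> al * y' + ro * x' <= 1 ->
  al * y + ro * x = 1 /\ al' * y - ro' * x = mu + x.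
Proof.
move=> mu1 al0 al'0 ro0 ro'0 a0 /andP[h1 h2] h3 /andP[h4 h5] h6.
have x1 : x <= 1 - mu by lra.
have y0 : 0 < y.
  rewrite -(pmulr_rgt0 _ al0).
  have : ro * x <= 0 by rewrite pmulr_rle0//; lra.
  lra.
have rx : ro * x <= 0 by rewrite pmulr_rle0//; lra.
have r'x : ro' * x <= 0 by rewrite pmulr_rle0//; lra.
have al'al : al' <= al by rewrite -(ler_pM2r y0); lra.
have [x'0|x'0] := ltP 0 x'.
  have : 0 < ro * x' by exact: mulr_gt0.
  have : 0 < ro' * x' by exact: mulr_gt0.
  move=> p1 p2.
  have y'0 : 0 < y' by rewrite -(pmulr_rgt0 _ al'0); lra.
  have : al < al' by rewrite -(ltr_pM2r y'0); lra.
  lra.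
have xx' : x <= x' by lra.
(* Eliminating [y] here and [y'] in [e2] leaves two bounds relating [x] and [x'] to [al' - al],
   which are incompatible with [x < x']. *)
have e1 : al' * (mu + x - ro * x) <= al * (mu + x + ro' * x).
  have p1 : al' * (mu + x - ro * x) <= al' * (al * y) by rewrite ler_pM2l//; lra.
  have p2 : al * (al' * y) <= al * (mu + x + ro' * x) by rewrite ler_pM2l//; lra.
  lra.
have e2 : al * (1 + ro' * x') <= al' * (1 - ro * x').
  have p1 : al * (1 + ro' * x') <= al * (al' * y') by rewrite ler_pM2l//; lra.
  have p2 : al' * (al * y') <= al' * (1 - ro * x') by rewrite ler_pM2l//; lra.
  lra.
have ex : x' <= x.
  rewrite leNgt; apply/negP => lt.
  have q1 : al' * (ro * (x' - x)) > 0 by rewrite !mulr_gt0//; lra.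
  have q2 : al * (ro' * (x' - x)) > 0 by rewrite !mulr_gt0//; lra.
  have q3 : 0 <= (al - al') * (1 - (mu + x)) by rewrite mulr_ge0//; lra.
  nra.
have {ex} ex : x = x' by lra.
subst x'.
have emu : mu + x = 1 by lra.
have p1 : al * y >= al * y' by lra.
have p2 : al' * y <= al' * y' by lra.
have ey : y = y'.
  by apply/eqP; rewrite eq_le; move: p1 p2; rewrite !ler_pM2l// => -> ->.
subst y'; split; lra.
Qed.

(** The constraints are homogeneous in [(a, x, y)] and in [(a', x', y')], so each triple may be
    divided by its first entry. *)
Lemma noncrossing_scalar (R : realFieldType) (mu al al' ro ro' a x y a' x' y' : R) :
  1 <= mu -> 0 < al -> 0 < al' -> 0 < ro -> 0 < ro' -> 0 < a -> 0 < a' ->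
  0 < mu * a + x ->
  mu * a + x <= al * y + ro * x <= a -> al' * y - ro' * x <= mu * a + x ->
  a' <= al' * y' - ro' * x' <= mu * a' + x' -> al * y' + ro * x' <= a' ->
  al * y + ro * x = a /\ al' * y - ro' * x = mu * a + x.
Proof.
move=> mu1 al0 al'0 ro0 ro'0 a0 a'0 s0 h1 h3 h4 h6.
have := @noncrossing_unit _ mu al al' ro ro' (x / a) (y / a) (x' / a') (y' / a')
  mu1 al0 al'0 ro0 ro'0.
have E1 : mu + x / a = (mu * a + x) / a by field; lra.
have E2 : al * (y / a) + ro * (x / a) = (al * y + ro * x) / a by field; lra.
have E3 : al' * (y / a) - ro' * (x / a) = (al' * y - ro' * x) / a by field; lra.
have E4 : mu + x' / a' = (mu * a' + x') / a' by field; lra.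
have E5 : al * (y' / a') + ro * (x' / a') = (al * y' + ro * x') / a' by field; lra.
have E6 : al' * (y' / a') - ro' * (x' / a') = (al' * y' - ro' * x') / a' by field; lra.
rewrite E1 E2 E3 E4 E5 E6 !ler_pM2r ?invr_gt0//.
rewrite ler_pdivrMr// ler_pdivlMr// !mul1r.
rewrite ler_pdivrMr// mul1r divr_gt0//.
move=> /(_ isT h1 h3 h4 h6)[] F1 F2; split.
  by move: F1 => /(congr1 (fun z => z * a)); rewrite mul1r divfK//; lra.
by move: F2 => /(congr1 (fun z => z * a)); rewrite !divfK//; lra.
Qed.

(** * Dot and cross products in the plane *)

Section Plane.
Variable R : realType.
Implicit Types u x y z : 'rV[R]_2.

Definition dot u y : R := u 0 0 * y 0 0 + u 0 1 * y 0 1.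

Lemma dotDr u x y : dot u (x + y) = dot u x + dot u y.
Proof. by rewrite /dot !mxE; ring. Qed.

Lemma dotNr u x : dot u (- x) = - dot u x.
Proof. by rewrite /dot !mxE; ring. Qed.

Lemma dotZr u a x : dot u (a *: x) = a * dot u x.
Proof. by rewrite /dot !mxE; ring. Qed.

Lemma dot0r u : dot u 0 = 0.
Proof. by rewrite /dot !mxE; ring. Qed.

Lemma dotDl u u' x : dot (u + u') x = dot u x + dot u' x.
Proof. by rewrite /dot !mxE; ring. Qed.

Lemma dotZl c u x : dot (c *: u) x = c * dot u x.
Proof. by rewrite /dot !mxE; ring. Qed.

Lemma dot0l x : dot 0 x = 0.
Proof. by rewrite /dot !mxE; ring. Qed.

Definition dotE := (dotDr, dotNr, dotZr, dot0r).

Lemma row2P x y : x 0 0 = y 0 0 -> x 0 1 = y 0 1 -> x = y.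
Proof.
move=> e0 e1; apply/rowP => k.
have [->|->] : k = 0 \/ k = 1 by case: k => [[|[|//]]] hk; [left|right]; apply/val_inj.
- exact: e0.
- exact: e1.
Qed.

Definition cross x y : R := x 0 0 * y 0 1 - x 0 1 * y 0 0.

(** The planar Binet-Cauchy identity. It serves to prove two functionals independent: if
    [cross u u'] vanishes, their values are proportional. *)
Lemma dot_dot_cross u u' x y :
  dot u x * dot u' y - dot u y * dot u' x = cross u u' * cross x y.
Proof. by rewrite /dot /cross; ring. Qed.

Lemma dot_inj2 u u' x y : cross u u' != 0 ->
  dot u x = dot u y -> dot u' x = dot u' y -> x = y.
Proof.
move=> d0 e e'.
have d : dot u (x - y) = 0 by rewrite !dotE e subrr.
have d' : dot u' (x - y) = 0 by rewrite !dotE e' subrr.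
apply/eqP; rewrite -subr_eq0; apply/eqP; move: (x - y) d d' => {x y e e'} z d d'.
have h0 : cross u u' * z 0 0 = 0.
  transitivity (dot u z * u' 0 1 - dot u' z * u 0 1); first by rewrite /cross /dot; ring.
  by rewrite d d'; ring.
have h1 : cross u u' * z 0 1 = 0.
  transitivity (dot u' z * u 0 0 - dot u z * u' 0 0); first by rewrite /cross /dot; ring.
  by rewrite d d'; ring.
by apply: row2P; rewrite mxE; apply: (mulfI d0); rewrite ?h0 ?h1 mulr0.
Qed.

Definition perp x : 'rV[R]_2 := \row_k (if k == 0 then - x 0 1 else x 0 0).

Lemma dot_perp u x : dot u (perp x) = cross x u.
Proof. by rewrite /dot /cross /perp !mxE /=; ring. Qed.

Lemma dot_gt0 x : x != 0 -> 0 < dot x x.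
Proof.
move=> x0; rewrite /dot -!expr2 lt_neqAle addr_ge0 ?sqr_ge0// andbT eq_sym.
rewrite paddr_eq0 ?sqr_ge0// !sqrf_eq0; apply: contra x0 => /andP[/eqP x00 /eqP x01].
by apply/eqP/row2P; rewrite mxE.
Qed.

End Plane.

(** * Noncrossing of two balls with a common site *)

Section Noncrossing.
Variables (R : realType) (I : eqType) (u : I -> 'rV[R]_2).
Implicit Types p q r v : 'rV[R]_2.

(** The strict inequalities exclude the vertices, so that a point determines the edge on which it
    lies. *)
Definition on_edge v (l : R) i p :=
  dot (u i) (p - v) = l /\ forall k, k != i -> dot (u k) (p - v) < l.

Lemma on_edge_le v l i p k : on_edge v l i p -> dot (u k) (p - v) <= l.
Proof.
by move=> [h1 h2]; have [->|/h2/ltW//] := eqVneq k i; rewrite h1.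
Qed.

Lemma on_edge_inj v l i p k : on_edge v l i p -> dot (u k) (p - v) = l -> k = i.
Proof.
by move=> [_ h2] e; apply/eqP; apply/negPn/negP => /h2; rewrite e ltxx.
Qed.

(* Otherwise the segments from [p] into the two balls would cross: [b] is the
   displacement of the second ball along the common edge, [s] and [s'] lie on the
   wrong sides of the level line of [f] through [p]. *)
Lemma noncrossing_sides (v v' p s s' f : 'rV[R]_2) (l l' : R) (i j j' : I) :
  0 < l -> l <= l' -> j != i -> j' != i -> j != j' ->
  on_edge v l i p -> on_edge v' l' i p ->
  on_edge v l j s -> on_edge v' l' j' s' ->
  (exists m, l' <= dot (u m) (s - v')) -> (exists m, l <= dot (u m) (s' - v)) ->
  cross f (u i) != 0 ->
  let b := v' - p - (l' / l) *: (v - p) in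
  0 < dot f (s - p) * dot f b -> 0 < - dot f (s' - p) * dot f b -> False.
Proof.
move=> l0 ll' ji j'i jj' Dp D'p Ds D's' [m hm] [m' hm'] fi b hs hs'.
set mu := l' / l.
have mul : mu * l = l' by rewrite /mu divfK//; lra.
have mu1 : 1 <= mu by rewrite /mu ler_pdivlMr// mul1r.
have fb0 : dot f b != 0 by apply: contraTneq hs => ->; rewrite mulr0 ltxx.
(* [e] points to the inner side of the common edge along a level line of [f], and [b] is parallel to
   that edge; together they form the basis for all coordinates below. *)
have [e fe ue] : exists2 e, dot f e = 0 & dot (u i) e = - 1.
  exists ((cross f (u i))^-1 *: - perp f); first by rewrite !dotE dot_perp /cross; ring.
  by rewrite !dotE dot_perp mulrN mulVf.
have ub : dot (u i) b = 0.
  rewrite /b !dotE -/mu; move: Dp.1 D'p.1; rewrite !dotE -mul => e1 e2.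
  rewrite (_ : dot (u i) v' = dot (u i) p - mu * l); last by lra.
  by rewrite (_ : dot (u i) v = dot (u i) p - l); [ring|lra].
have decomp x : x - p = (- dot (u i) (x - p)) *: e + (dot f (x - p) / dot f b) *: b.
  apply: (dot_inj2 fi); rewrite [RHS]dotDr !dotZr ?fe ?ue ?ub; last by ring.
  by rewrite mulr0 add0r divfK.
have dec m0 x : dot (u m0) (x - p) =
    (- dot (u i) (x - p)) * dot (u m0) e + (dot f (x - p) / dot f b) * dot (u m0) b.
  by rewrite {1}decomp dotDr !dotZr.
(* [a m0] is the slack at [p] of a constraint of the first ball; scaling it by [mu] and adding the
   effect of [b] gives the slack for the second ball. *)
pose a m0 := l - dot (u m0) (p - v).
have a'E m0 : l' - dot (u m0) (p - v') = mu * a m0 + dot (u m0) b.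
  by rewrite /a /b -/mu -mul !dotE; ring.
have a0 m0 : m0 != i -> 0 < a m0 by move/Dp.2; rewrite /a; lra.
have a'0 m0 : m0 != i -> 0 < mu * a m0 + dot (u m0) b.
  by move/D'p.2; rewrite -a'E; lra.
have als : 0 < - dot (u i) (s - p).
  by move: (Ds.2 i); rewrite eq_sym => /(_ ji); move: Dp.1; rewrite !dotE; lra.
have als' : 0 < - dot (u i) (s' - p).
  by move: (D's'.2 i); rewrite eq_sym => /(_ j'i); move: D'p.1; rewrite !dotE; lra.
have ros : 0 < dot f (s - p) / dot f b.
  have -> : dot f (s - p) / dot f b = dot f (s - p) * dot f b / (dot f b ^+ 2) by field.
  by rewrite divr_gt0// exprn_even_gt0.
have ros' : 0 < - (dot f (s' - p) / dot f b).
  have -> : - (dot f (s' - p) / dot f b) = - dot f (s' - p) * dot f b / (dot f b ^+ 2) by field.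
  by rewrite divr_gt0// exprn_even_gt0.
have sle m0 : dot (u m0) (s - p) <= a m0.
  by have := on_edge_le m0 Ds; rewrite /a !dotE; lra.
have s'le m0 : dot (u m0) (s' - p) <= mu * a m0 + dot (u m0) b.
  by rewrite -a'E; have := on_edge_le m0 D's'; rewrite !dotE; lra.
have sm : mu * a m + dot (u m) b <= dot (u m) (s - p).
  by rewrite -a'E; move: hm; rewrite !dotE; lra.
have s'm' : a m' <= dot (u m') (s' - p) by rewrite /a; move: hm'; rewrite !dotE; lra.
have mi : m != i.
  apply/eqP => mi; subst m; move: sm; rewrite /a ub; move: Dp.1; rewrite !dotE.
  by move=> ->; move: als; rewrite !dotE; lra.
have m'i : m' != i.
  apply/eqP => mi'; subst m'; move: s'm'; rewrite /a; move: Dp.1; rewrite !dotE.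
  by move=> ->; move: als'; rewrite !dotE; lra.
have := @noncrossing_scalar _ mu (- dot (u i) (s - p)) (- dot (u i) (s' - p))
  (dot f (s - p) / dot f b) (- (dot f (s' - p) / dot f b))
  (a m) (dot (u m) b) (dot (u m) e) (a m') (dot (u m') b) (dot (u m') e)
  mu1 als als' ros ros' (a0 _ mi) (a0 _ m'i) (a'0 _ mi).
rewrite !mulNr !opprK -!mulNr -!dec sm s'm' !sle !s'le => /(_ isT isT isT isT)[E E'].
have mj : m = j by apply: (on_edge_inj Ds); move: E; rewrite /a !dotE; lra.
have mj' : m = j' by apply: (on_edge_inj D's'); move: E'; rewrite -a'E !dotE; lra.
by move: jj'; rewrite -mj -mj' eqxx.
Qed.

(** If [f] does not vanish on the displacement [b] between the balls, its sign selects one of the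
    pairs [(r, q')] and [(q, r')], to which the preceding lemma applies. If it does, [b = 0] and the
    balls are homothetic from [p]; unequal radii would then put [q] in the interior of the larger
    one. *)
Lemma noncrossing (v v' p q r q' r' f : 'rV[R]_2) (l l' : R) (i j k : I) :
  0 < l -> 0 < l' -> j != i -> k != i -> j != k ->
  on_edge v l i p -> on_edge v' l' i p ->
  on_edge v l j q -> on_edge v' l' j q' ->
  on_edge v l k r -> on_edge v' l' k r' ->
  (exists m, l' <= dot (u m) (q - v')) -> (exists m, l' <= dot (u m) (r - v')) ->
  (exists m, l <= dot (u m) (q' - v)) -> (exists m, l <= dot (u m) (r' - v)) ->
  dot f q < dot f p < dot f r -> dot f q' < dot f p < dot f r' ->
  v = v' /\ l = l'.
Proof.
move=> + + ji ki jk.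
wlog ll' : v v' q q' r r' l l' / l <= l'.
  move=> W l0 l'0 Dp D'p Dq D'q' Dr D'r' q_ r_ q'_ r'_ f1 f2.
  have [ll'|/ltW ll'] := leP l l'; first exact: (W v v' q q' r r' l l').
  by have [] := W v' v q' q r' r l' l ll' l'0 l0 D'p Dp D'q' Dq D'r' Dr q'_ r'_ q_ r_ f2 f1.
move=> l0 l'0 Dp D'p Dq D'q' Dr D'r' q_ r_ q'_ r'_ /andP[f1 f2] /andP[f3 f4].
(* [q] and [r] lie on the same side of the edge line through [p] but on opposite sides of the level
   line of [f], so these lines differ. *)
have fi : cross f (u i) != 0.
  apply/eqP => f0; have := dot_dot_cross f (u i) (q - p) (r - p); rewrite f0 mul0r.
  have q0 : dot (u i) (q - p) < 0.
    by move: (Dq.2 i); rewrite eq_sym => /(_ ji); move: Dp.1; rewrite !dotE; lra.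
  have r0 : dot (u i) (r - p) < 0.
    by move: (Dr.2 i); rewrite eq_sym => /(_ ki); move: Dp.1; rewrite !dotE; lra.
  have fq : dot f (q - p) < 0 by rewrite !dotE; lra.
  have fr : 0 < dot f (r - p) by rewrite !dotE; lra.
  have : 0 < dot f (q - p) * dot (u i) (r - p) by nra.
  have : dot f (r - p) * dot (u i) (q - p) < 0 by nra.
  lra.
pose b := v' - p - (l' / l) *: (v - p).
have kj : k != j by rewrite eq_sym.
have [fb|fb|fb] := ltgtP 0 (dot f b).
- exfalso; apply: (noncrossing_sides l0 ll' ki ji kj Dp D'p Dr D'q' r_ q'_ fi).
    by rewrite mulr_gt0//= !dotE; lra.
  by rewrite mulr_gt0//= !dotE; lra.
- exfalso; apply: (noncrossing_sides l0 ll' ji ki jk Dp D'p Dq D'r' q_ r'_ fi).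
    by rewrite nmulr_rgt0//= !dotE; lra.
  by rewrite nmulr_rgt0//= !dotE; lra.
pose mu := l' / l.
have mul : mu * l = l' by rewrite /mu divfK//; lra.
have b0 : b = 0.
  apply: (dot_inj2 fi); rewrite dot0r -?fb//.
  rewrite /b !dotE -/mu; move: Dp.1 D'p.1; rewrite !dotE -mul => e1 e2.
  rewrite (_ : dot (u i) v' = dot (u i) p - mu * l); last by lra.
  by rewrite (_ : dot (u i) v = dot (u i) p - l); [ring|lra].
have v'E : v' = p + mu *: (v - p).
  by apply/eqP; rewrite -subr_eq0 opprD addrA; apply/eqP.
have [mu1|mu1] := leP mu 1.
  have mu_eq : mu = 1.
    by apply/eqP; rewrite eq_le mu1 /mu ler_pdivlMr// mul1r.
  by split; [rewrite v'E mu_eq scale1r addrC subrK|rewrite -mul mu_eq mul1r].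
exfalso; case: q_ => m; rewrite v'E !dotE -mul => hm.
have am : dot (u m) (p - v) <= l by apply: on_edge_le Dp.
have qm : dot (u m) (q - v) <= l by apply: on_edge_le Dq.
have [mi|mi] := eqVneq m i.
  subst m; move: (Dq.2 i); rewrite eq_sym => /(_ ji); move: Dp.1; rewrite !dotE.
  by move=> e1; rewrite (_ : dot (u i) v = dot (u i) p - l) in hm *; nra.
by move: (Dp.2 _ mi) am qm; rewrite !dotE; nra.
Qed.

End Noncrossing.

(** * Small positive perturbations and closed half-spaces *)

Lemma near_affine (R : realType) (a b : R) : 0 < a ->
  \forall t \near (0 : R)^'+, 0 < a + t * b.
Proof.
move=> a0; have b1 : 0 < `|b| + 1 by have := normr_ge0 b; lra.
have c0 : 0 < a / (`|b| + 1) by rewrite divr_gt0.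
near=> t; have t0 : 0 < t by near: t; exact: nbhs_right_gt.
have : t < a / (`|b| + 1) by near: t; exact: nbhs_right_lt.
rewrite ltr_pdivlMr// => ta.
have : - `|b| <= b by rewrite lerNl -normrN ler_norm.
have := normr_ge0 b; nra.
Unshelve. all: by end_near. Qed.

Lemma near_all_seq (T : Type) (F : set_system T) (J : eqType) (s : seq J)
    (P : J -> T -> Prop) : Filter F ->
  (forall j, j \in s -> \forall t \near F, P j t) ->
  \forall t \near F, forall j, j \in s -> P j t.
Proof.
move=> FF; elim: s => [_|j s IH H]; first exact: nearW.
have := IH (fun k ks => H k (mem_behead (s := j :: s) ks)).
apply: filterS2 (H j (mem_head _ _)) => t h1 h2 k.
by rewrite inE => /orP[/eqP->//|/h2].
Qed.

Lemma dot_continuous (R : realType) (w : 'rV[R]_2) : continuous (dot w).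
Proof.
move=> y.
have co k : (w 0 k * z 0 k) @[z --> nbhs y] --> w 0 k * y 0 k.
  by apply: (@cvgM _ _ (nbhs y)); [exact: cvg_cst|exact: coord_continuous].
exact: (cvgD (co 0) (co 1)).
Qed.

Lemma closed_half_space (R : realType) (w : 'rV[R]_2) (a c : R) :
  closed [set X : 'rV[R]_2 * R | c <= dot w X.1 + a * X.2].
Proof.
apply: (@preimage_closed _ _ (fun X : 'rV[R]_2 * R => dot w X.1 + a * X.2)
  [set x | c <= x]); last exact: closed_ge.
move=> /= X _.
have h1 : dot w Y.1 @[Y --> X] --> dot w X.1.
  by apply: (@cvg_comp _ _ _ fst (dot w)); [exact: cvg_fst|exact: dot_continuous].
apply: (cvgD h1); apply: cvgM; [exact: cvg_cst|exact: cvg_snd].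
Qed.

(** * Empty balls of a polyhedral gauge *)

Definition bounded_gauge (R : realType) (I : finType) (u : I -> 'rV[R]_2) :=
  exists M, forall y, (forall m, dot (u m) y <= 1) -> forall k, `|y 0 k| <= M.

Definition irredundant_gauge (R : realType) (I : finType) (u : I -> 'rV[R]_2) :=
  forall m, exists2 z, dot (u m) z = 1 & forall k, k != m -> dot (u k) z < 1.

Section Gauge.
Variables (R : realType) (I : finType) (u : I -> 'rV[R]_2).
Hypotheses (bounded_u : bounded_gauge u) (facet_u : irredundant_gauge u).
Implicit Types (v w x y z p q : 'rV[R]_2) (l t : R) (Q : seq 'rV[R]_2).

(** A nonzero [d] would span a ray inside the bounded unit ball. *)
Lemma recession d : (forall m, dot (u m) d <= 0) -> d = 0.
Proof.
have [M hM] := bounded_u; move=> hd; apply/rowP => k; rewrite mxE.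
apply/eqP/negPn/negP => dk; have ndk : 0 < `|d 0 k| by rewrite normr_gt0.
have M0 : 0 <= M.
  apply: (le_trans (normr_ge0 ((0 : 'rV[R]_2) 0 k))); apply: hM => m.
  by rewrite dot0r.
have := hM (((M + 1) / `|d 0 k|) *: d) _ k; rewrite mxE normrM gtr0_norm ?divr_gt0//; last by lra.
rewrite divfK; last by lra.
suff h m : dot (u m) (((M + 1) / `|d 0 k|) *: d) <= 1 by move=> /(_ h); lra.
rewrite dotZr; apply: le_trans (_ : 0 <= 1) => //.
by rewrite mulr_ge0_le0// divr_ge0//; lra.
Qed.

Lemma facet_exists : inhabited I.
Proof.
apply: contrapT => nI.
have /rowP/(_ 0) : (const_mx 1 : 'rV[R]_2) = 0.
  by apply: recession => m; case: nI; exists.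
by rewrite !mxE => /eqP; rewrite oner_eq0.
Qed.

(** Proportional normals with value 1 at a common point would agree, against irredundancy. *)
Lemma cross_facets i j y : i != j -> dot (u i) y = 1 -> dot (u j) y = 1 ->
  cross (u i) (u j) != 0.
Proof.
move=> ij yi yj; apply/eqP => c0; have [z zi /(_ j)] := facet_u i.
rewrite eq_sym => /(_ ij) zj.
by have := dot_dot_cross (u i) (u j) y z; rewrite c0 yi yj zi; lra.
Qed.

Lemma vertex_uniq i j y y' : i != j -> dot (u i) y = 1 -> dot (u j) y = 1 ->
  dot (u i) y' = 1 -> dot (u j) y' = 1 -> y = y'.
Proof.
move=> ij yi yj y'i y'j; apply: (dot_inj2 (cross_facets ij yi yj)).
  by rewrite yi y'i.
by rewrite yj y'j.
Qed.

Definition in_ball v l y := forall m, dot (u m) (y - v) <= l.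

(** Every [u m] has maximum 1 on the unit ball, so the middle condition expresses containment in
    that ball. Radius 0 is allowed to keep the set of pairs closed. *)
Definition admissible Q v l :=
  [/\ 0 <= l, forall m, dot (u m) v + l <= 1 &
      forall q, q \in Q -> exists m, l <= dot (u m) (q - v)].

(* The first alternative says that the [m]-th edge lies on the [m]-th edge of the
   unit ball. *)
Definition touched Q v l m := dot (u m) v + l = 1 \/
  exists q, [/\ q \in Q, in_ball v l q & dot (u m) (q - v) = l].

(** [mu + dot (u m) w] is the outward speed of the [m]-th edge. Obstacles away from the ball leave
    room for a short motion, and an edge that meets an obstacle does not move outward. *)
Lemma admissible_near Q v l w mu : admissible Q v l -> 0 < l ->
  (forall m, touched Q v l m -> mu + dot (u m) w <= 0) ->
  \forall t \near (0 : R)^'+, admissible Q (v + t *: w) (l + t * mu).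
Proof.
move=> [_ wall site] l0 ht.
have N0 : \forall t \near (0 : R)^'+, 0 < l + t * mu by exact: near_affine.
have N1 : \forall t \near (0 : R)^'+, forall m, dot (u m) (v + t *: w) + (l + t * mu) <= 1.
  apply: filter_forall => m.
  have := wall m; rewrite le_eqVlt => /orP[/eqP em|lm].
    near=> t; have t0 : 0 < t by near: t; exact: nbhs_right_gt.
    by have := ht m (or_introl em); rewrite !dotE; nra.
  have lm' : 0 < 1 - (dot (u m) v + l) by lra.
  near=> t.
  have : 0 < 1 - (dot (u m) v + l) + t * - (dot (u m) w + mu).
    by near: t; exact: near_affine.
  by rewrite !dotE; lra.
have N2 : \forall t \near (0 : R)^'+, forall q, q \in Q ->
    exists m, l + t * mu <= dot (u m) (q - (v + t *: w)).
  apply: near_all_seq => q qQ.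
  have [qv|qv] := pselect (in_ball v l q).
    have [m lm] := site q qQ.
    have em : dot (u m) (q - v) = l by apply/eqP; rewrite eq_le lm qv.
    near=> t; have t0 : 0 < t by near: t; exact: nbhs_right_gt.
    exists m; have := ht m (or_intror (ex_intro _ q (And3 qQ qv em))).
    by move: em; rewrite !dotE; nra.
  have [m /negP] := (not_existsP _).2 (fun h => qv (fun m => contrapT (h m))).
  rewrite -ltNge -subr_gt0 => lm.
  near=> t; exists m.
  have : 0 < dot (u m) (q - v) - l + t * - (dot (u m) w + mu).
    by near: t; exact: near_affine.
  by rewrite !dotE; lra.
near=> t; split; first by apply: ltW; near: t.
- by near: t.
- by near: t.
Unshelve. all: by end_near. Qed.

Lemma on_edge_near v l p i w mu : on_edge u v l i p -> mu + dot (u i) w = 0 ->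
  \forall t \near (0 : R)^'+, on_edge u (v + t *: w) (l + t * mu) i p.
Proof.
move=> [pi pk] wi.
have : \forall t \near (0 : R)^'+, forall k, k != i ->
    dot (u k) (p - (v + t *: w)) < l + t * mu.
  apply: filter_forall => k; have [->|/pk] := eqVneq k i; first exact: nearW.
  rewrite -subr_gt0 => lk; near=> t => _.
  have : 0 < l - dot (u k) (p - v) + t * (mu + dot (u k) w).
    by near: t; exact: near_affine.
  by rewrite !dotE; lra.
apply: filterS => t; split => //.
by move: pi; rewrite !dotE => pi; nra.
Unshelve. all: by end_near. Qed.

Lemma start_ball Q x : (forall m, dot (u m) x <= 1) ->
  exists v l, [/\ 0 < l, admissible Q v l & in_ball v l x].
Proof.
move=> xC.
(* The ball of radius [t] about [x - t *: z] has [x] in position [z]. A boundary position keeps [x]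
   out of the interior in case it is a site; for [x] on the boundary, [z = x] shrinks the unit ball
   towards [x]. *)
have [z [zC [m0 zm0] zx]] : exists z, [/\ forall m, dot (u m) z <= 1,
    exists m, dot (u m) z = 1 & forall m, dot (u m) x < 1 \/ dot (u m) z = dot (u m) x].
  have [[m xm]|nx] := pselect (exists m, dot (u m) x = 1).
    by exists x; split => //; [exists m|right].
  have [m] := facet_exists; have [z zm zk] := facet_u m.
  exists z; split; [|by exists m|].
    by move=> k; have [->|/zk/ltW//] := eqVneq k m; rewrite zm.
  move=> k; left; rewrite lt_neqAle xC andbT; apply/eqP => xk.
  by apply: nx; exists k.
have N1 : \forall t \near (0 : R)^'+, forall m, dot (u m) (x - t *: z) + t <= 1.
  apply: filter_forall => m; have [xm|zxm] := zx m.
    rewrite -subr_gt0 in xm; near=> t.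
    have : 0 < 1 - dot (u m) x + t * (dot (u m) z - 1).
      by near: t; exact: near_affine.
    by rewrite !dotE; lra.
  near=> t; have t0 : 0 < t by near: t; exact: nbhs_right_gt.
  have t1 : t < 1 by near: t; exact: nbhs_right_lt.
  by rewrite !dotE zxm; have := xC m; nra.
have N2 : \forall t \near (0 : R)^'+, forall q, q \in Q ->
    exists m, t <= dot (u m) (q - (x - t *: z)).
  apply: near_all_seq => q qQ; have [->|qx] := eqVneq q x.
    by near=> t; exists m0; rewrite !dotE zm0; lra.
  have [m] : exists m, 0 < dot (u m) (q - x).
    apply: contrapT => h; move/eqP: qx; apply; apply/eqP; rewrite -subr_eq0.
    apply/eqP; apply: recession => m; rewrite leNgt; apply/negP => h'.
    by apply: h; exists m.
  move=> qm; near=> t; exists m.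
  have : 0 < dot (u m) (q - x) + t * (dot (u m) z - 1).
    by near: t; exact: near_affine.
  by rewrite !dotE; lra.
have [t [t0 h1 h2]] : exists t : R, [/\ 0 < t,
    forall m, dot (u m) (x - t *: z) + t <= 1 & forall q, q \in Q ->
    exists m, t <= dot (u m) (q - (x - t *: z))].
  apply: (@filter_ex _ (0 : R)^'+); near=> t; split.
  - by near: t; exact: nbhs_right_gt.
  - by near: t.
  - by near: t.
exists (x - t *: z), t; split=> //; first by split=> //; exact: ltW.
by move=> m; have := zC m; rewrite !dotE; nra.
Unshelve. all: by end_near. Qed.

Lemma admissible_closed Q : closed [set X : 'rV[R]_2 * R | admissible Q X.1 X.2].
Proof.
have -> : [set X : 'rV[R]_2 * R | admissible Q X.1 X.2] =
  [set X : 'rV[R]_2 * R | 0 <= dot 0 X.1 + 1 * X.2] `&`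
  (\bigcap_(m in [set: I]) [set X : 'rV[R]_2 * R | -1 <= dot (- u m) X.1 + (-1) * X.2] `&`
  \bigcap_(q in [set` Q]) \bigcup_(m in [set: I])
     [set X : 'rV[R]_2 * R | - dot (u m) q <= dot (- u m) X.1 + (-1) * X.2]).
  apply/seteqP; split=> -[v l] /=.
    move=> [l0 wall site]; split; first by rewrite /dot !mxE; lra.
    split => [m _|q /site[m hm]] /=; first by have := wall m; rewrite /dot !mxE; lra.
    by exists m => //=; move: hm; rewrite /dot !mxE; lra.
  move=> [l0 [wall site]]; split; first by move: l0; rewrite /dot !mxE; lra.
    by move=> m; have /= := wall m Logic.I; rewrite /dot !mxE; lra.
  move=> q /site[m _ hm]; exists m; move: hm => /=; rewrite /dot !mxE; lra.
apply: closedI; first exact: closed_half_space.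
apply: closedI; first by apply: closed_bigI => m _; exact: closed_half_space.
apply: closed_bigI => q _; apply: closed_bigcup => [|m _]; first exact: finite_finset.
exact: closed_half_space.
Qed.

(** Admissible pairs form a compact set: the centre lies in the unit ball, and a radius above 1
    would make the centre a recession direction, hence 0, which is absurd. *)
Lemma max_radius Q (A : set ('rV[R]_2 * R)) : closed A ->
  (exists v l, admissible Q v l /\ A (v, l)) ->
  exists v l, [/\ admissible Q v l, A (v, l) &
    forall v' l', admissible Q v' l' -> A (v', l') -> l' <= l].
Proof.
move=> clA [v0 [l0 [ad0 A0]]]; have [M hM] := bounded_u.
pose E := [set X : 'rV[R]_2 * R | admissible Q X.1 X.2] `&` A.
have clE : closed E by apply: closedI => //; exact: admissible_closed.
have cE : compact E.
  have cB : compact ([set y : 'rV[R]_2 | forall k, (`[- M, M]%classic : set R) (y 0 k)]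
      `*` `[0 : R, 1]%classic).
    apply: compact_setX; last exact: segment_compact.
    by apply: (@rV_compact _ _ (fun=> `[- M, M]%classic)) => _; exact: segment_compact.
  apply: (subclosed_compact clE cB).
  move=> [v l] [/= [l_ge0 wall _] _]; split => /=.
    move=> k; rewrite in_itv/= -ler_norml; apply: hM => m.
    by have := wall m; lra.
  rewrite in_itv/= l_ge0/= leNgt; apply/negP => l1.
  have v00 : v = 0 by apply: recession => m; have := wall m; lra.
  have [m] := facet_exists; have := wall m; rewrite v00 dot0r; lra.
have [| |[v l]] := @compact_EVT_max _ R snd E _ cE.
- by exists (v0, l0).
- by apply: continuous_subspaceT => X; exact: cvg_snd.
rewrite inE => -[ad Avl] mx; exists v, l; split=> // v' l' ad' A'.
by apply: (mx (v', l')); rewrite inE.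
Qed.

End Gauge.

(** * Sites on the walls *)

Lemma dot_bound (R : realType) (w : 'rV[R]_2) (M : R) : exists2 B, 0 < B &
  forall y : 'rV[R]_2, (forall k, `|y 0 k| <= M) -> `|dot w y| <= B.
Proof.
exists ((`|w 0 0| + `|w 0 1|) * `|M| + 1).
  have h : 0 <= (`|w 0 0| + `|w 0 1|) * `|M| by rewrite mulr_ge0// addr_ge0.
  by lra.
move=> y hy; rewrite /dot.
have h k : `|w 0 k * y 0 k| <= `|w 0 k| * `|M|.
  by rewrite normrM ler_wpM2l// (le_trans (hy k))// ler_norm.
by apply: le_trans (ler_normD _ _) _; have := h 0; have := h 1; lra.
Qed.

Lemma finite_net (R : realType) (B d : R) : 0 < d ->
  exists T : seq R, forall x, `|x| <= B -> exists2 t, t \in T & `|t - x| <= d.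
Proof.
move=> d0; pose N := Num.truncn ((B + B) / d).
exists [seq - B + d * k%:R | k <- iota 0 N.+1] => x; rewrite ler_norml => /andP[x1 x2].
have x0 : 0 <= (x + B) / d by rewrite divr_ge0//; lra.
have /andP[n1 n2] := truncn_itv x0; set n := Num.truncn _ in n1 n2.
exists (- B + d * n%:R).
  apply/mapP; exists n => //; rewrite mem_iota/= add0n ltnS /N /n; apply: le_truncn.
  by rewrite ler_pM2r ?invr_gt0//; lra.
move: n1 n2; rewrite ler_pdivlMr// ltr_pdivrMr// -natr1 ler_norml.
by move=> ? ?; apply/andP; split; lra.
Qed.

Section Walls.
Variables (R : realType) (I : finType) (u : I -> 'rV[R]_2).
Hypotheses (bounded_u : bounded_gauge u) (facet_u : irredundant_gauge u).
Implicit Types (v w x y z p q : 'rV[R]_2) (l t : R) (Q : seq 'rV[R]_2).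

Lemma edge_segment j z : dot (u j) z = 1 -> (forall k, k != j -> dot (u k) z < 1) ->
  exists2 d, 0 < d & forall s m, `|s| <= d -> dot (u m) (z + s *: perp (u j)) <= 1.
Proof.
move=> zj zk.
have N b : \forall t \near (0 : R)^'+, forall m, m != j ->
    0 < 1 - dot (u m) z + t * (b * dot (u m) (perp (u j))).
  apply: filter_forall => m; have [->|/zk] := eqVneq m j; first exact: nearW.
  rewrite -subr_gt0 => zm; near=> t => _; near: t; exact: near_affine.
have [d [d0 h1 h2]] : exists d : R, [/\ 0 < d,
    forall m, m != j -> 0 < 1 - dot (u m) z + d * (1 * dot (u m) (perp (u j))) &
    forall m, m != j -> 0 < 1 - dot (u m) z + d * (-1 * dot (u m) (perp (u j)))].
  apply: (@filter_ex _ (0 : R)^'+); near=> t; split.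
  - by near: t; exact: nbhs_right_gt.
  - by near: t.
  - by near: t.
exists d => // s m; rewrite ler_norml => /andP[s1 s2]; rewrite !dotE.
have [->|mj] := eqVneq m j; first by rewrite zj dot_perp /cross; lra.
have := h1 m mj; have := h2 m mj; nra.
Unshelve. all: by end_near. Qed.

(* [y] is the position in the ball of a site on its [i]-th edge, and
   [1 - dot (u j) y] is proportional to the distance from the site to the line of
   the [j]-th edge; finitely many directions [k], scaled by that distance, reach
   the [j]-th edge whatever [y] is. *)
Lemma wall_directions i j : i != j -> exists K : seq 'rV[R]_2,
  (forall k, k \in K -> dot (u j) k = 1) /\
  forall y, (forall m, dot (u m) y <= 1) -> dot (u i) y = 1 -> dot (u j) y < 1 ->
    exists2 k, k \in K & forall m, dot (u m) (y + (1 - dot (u j) y) *: k) <= 1.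
Proof.
move=> ij; have [zi zii zik] := facet_u i.
have zij : dot (u j) zi < 1 by apply: zik; rewrite eq_sym.
have [[y' [y'C y'i y'j]]|nadj] := pselect (exists y,
    [/\ forall m, dot (u m) y <= 1, dot (u i) y = 1 & dot (u j) y = 1]).
  (* If the edges share the vertex [y'], one direction along the [i]-th edge suffices, since it
     carries every [y] in question to [y']. *)
  exists [:: (1 - dot (u j) zi)^-1 *: (y' - zi)]; split=> [k|y yC yi yj].
    by rewrite inE => /eqP->; rewrite !dotE y'j mulVf//; lra.
  exists ((1 - dot (u j) zi)^-1 *: (y' - zi)); first exact: mem_head.
  rewrite (_ : _ + _ = y')//; apply: (vertex_uniq facet_u ij) => //.
    by rewrite !dotE y'i zii yi; ring.
  by rewrite !dotE y'j; field; lra.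
have [M hM] := bounded_u.
(* Otherwise compactness keeps the [i]-th edge at a positive distance from the line of the [j]-th,
   which bounds the parameters needed below. *)
have [e e0 he] : exists2 e, 0 < e & forall y, (forall m, dot (u m) y <= 1) ->
    dot (u i) y = 1 -> e <= 1 - dot (u j) y.
  pose E := [set y : 'rV[R]_2 | (forall m, dot (u m) y <= 1) /\ 1 <= dot (u i) y].
  have cE : compact E.
    apply: bounded_closed_compact; last first.
      have -> : E = (\bigcap_(m in [set: I]) (dot (u m) @^-1` [set x | x <= 1])) `&`
          (dot (u i) @^-1` [set x | 1 <= x]).
        apply/seteqP; split=> y /= [h1 h2]; split=> //; first by move=> m _; exact: h1.
        by move=> m; apply: h1.
      apply: closedI; last first.
        by apply: preimage_closed; [move=> ? _; exact: dot_continuous|exact: closed_ge].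
      apply: closed_bigI => m _.
      by apply: preimage_closed; [move=> ? _; exact: dot_continuous|exact: closed_le].
    exists `|M|; split; first exact: normr_real.
    move=> B MB y [/hM hy _]; rewrite /= [`|y|]mx_normrE; apply/bigmax_leP; split.
      by apply: ltW; apply: le_lt_trans MB.
    move=> [k1 k2] _ /=; rewrite (ord1 k1); apply: le_trans (hy k2) _.
    by apply: le_trans (ler_norm _) _; exact: ltW.
  have [| |c] := @compact_EVT_max _ R (dot (u j)) E _ cE.
  - exists zi; split; last by rewrite zii.
    by move=> m; have [->|/zik/ltW//] := eqVneq m i; rewrite zii.
  - by apply: continuous_subspaceT => y; exact: dot_continuous.
  rewrite inE => -[cC ci] mx; exists (1 - dot (u j) c).
    rewrite subr_gt0 lt_neqAle cC andbT; apply/eqP => cj; apply: nadj; exists c.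
    by split=> //; apply/eqP; rewrite eq_le ci cC.
  move=> y yC yi; have := mx y; rewrite inE /E /= yi => /(_ (conj yC (lexx _))); lra.
have [zj zjj zjk] := facet_u j; have [d d0 hd] := edge_segment zjj zjk.
pose tau := perp (u j).
have ttauE : dot tau tau = dot (u j) (u j).
  by rewrite dot_perp /cross /tau /dot !mxE /=; ring.
have ttau : 0 < dot tau tau.
  rewrite ttauE dot_gt0//; apply/eqP => u0; move: zjj; rewrite u0 dot0l; lra.
have [B1 B10 hB1] := dot_bound tau M; have [B2 B20 hB2] := dot_bound (u j) M.
have dB : 0 < d / (1 + B2) by rewrite divr_gt0//; lra.
(* The parameter [t0] below lands exactly on [zj]. An error in it is multiplied by at most [1 + B2],
   and the edge extends by [d] on both sides of [zj]; hence the mesh. The first argument bounds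
   every [t0] in absolute value. *)
have [T hT] := finite_net
  ((B1 + `|dot tau zj|) / e / dot tau tau + `|dot tau zj| / dot tau tau) dB.
exists [seq zj + t *: tau | t <- T]; split=> [k /mapP[t _ ->]|y yC yi yj].
  by rewrite !dotE zjj /tau dot_perp /cross; ring.
set c := 1 - dot (u j) y; have ec : e <= c by exact: he.
have cB : c <= 1 + B2.
  by have := hB2 y (hM y yC); rewrite ler_norml /c => /andP[]; lra.
pose t0 := - (dot tau (y - zj) / c + dot tau zj) / dot tau tau.
have [t tT htt0] : exists2 t, t \in T & `|t - t0| <= d / (1 + B2).
  apply: hT; rewrite /t0 normrM normrN normfV (gtr0_norm ttau) -mulrDl.
  rewrite ler_pM2r ?invr_gt0//; apply: le_trans (ler_normD _ _) _.
  rewrite lerD2r normrM normfV (@gtr0_norm _ c); last by lra.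
  apply: ler_pM => //; first by rewrite invr_ge0; lra.
    by rewrite !dotE; apply: le_trans (ler_normB _ _) _; rewrite lerD2r hB1//; exact: hM.
  by rewrite lef_pV2 ?posrE//; lra.
exists (zj + t *: tau); first by apply/mapP; exists t.
have -> : y + c *: (zj + t *: tau) = zj + (c * (t - t0)) *: tau.
  apply: (@dot_inj2 _ (u j) tau).
  - suff -> : cross (u j) tau = dot tau tau by rewrite gt_eqF.
    by rewrite ttauE /cross /tau /dot !mxE /=; ring.
  - by rewrite !dotE zjj /tau dot_perp /cross /c; ring.
  - by rewrite !dotE /t0 !dotE; field; apply/andP; split; lra.
move=> m; apply: hd; rewrite normrM (@gtr0_norm _ c); last by lra.
have : c * `|t - t0| <= (1 + B2) * (d / (1 + B2)).
  by apply: ler_pM => //; lra.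
by rewrite (_ : (1 + B2) * (d / (1 + B2)) = d)//; field; lra.
Qed.

End Walls.

(** * Sliding *)

Lemma at_right0_ex (R : realType) (P : R -> Prop) :
  (\forall t \near (0 : R)^'+, P t) ->
  exists2 e : R, 0 < e & forall t, 0 < t <= e -> P t.
Proof.
move=> /nbhs_ballP[e /= e0 he]; exists (e / 2); first by rewrite divr_gt0.
move=> t /andP[t0 te]; apply: (he t) => //=.
by rewrite /ball/= sub0r normrN gtr0_norm//; lra.
Qed.

Section Sliding.
Variables (R : realType) (I : finType) (u : I -> 'rV[R]_2).
Hypotheses (bounded_u : bounded_gauge u) (facet_u : irredundant_gauge u).
Implicit Types (v w x y z p q : 'rV[R]_2) (l t : R) (Q : seq 'rV[R]_2).

Definition disjoint_edges i j := forall y, (forall m, dot (u m) y <= 1) ->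
  dot (u i) y = 1 -> dot (u j) y = 1 -> False.

Lemma disjoint_edges_ball i j v l y : disjoint_edges i j -> 0 < l ->
  in_ball u v l y -> dot (u i) (y - v) = l -> dot (u j) (y - v) = l -> False.
Proof.
move=> dj l0 hy hi hj; apply: (dj (l^-1 *: (y - v))).
- by move=> m; rewrite dotZr ler_pdivrMl// mulr1; exact: hy.
- by rewrite dotZr hi mulVf//; lra.
- by rewrite dotZr hj mulVf//; lra.
Qed.

(* [y] and [x] lie on the same trajectory of the family of homotheties (or
   translations) carrying the ball [(v, l)] to [(v + t *: w, l + t * mu)]. *)
Lemma slide_decomposition i j v l w mu y x : i != j -> 0 < l -> w != 0 ->
  mu + dot (u i) w = 0 -> mu + dot (u j) w = 0 ->
  forall r, l - dot (u i) (y - v) = r * (l - dot (u i) (x - v)) ->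
  l - dot (u j) (y - v) = r * (l - dot (u j) (x - v)) ->
  exists2 eta, r * l = l - eta * mu & y - v = r *: (x - v) - eta *: w.
Proof.
move=> ij l0 w0 wi wj r ri rj.
have hi : dot (u i) (y - v - r *: (x - v)) = (1 - r) * l.
  by move: ri; rewrite !dotE; lra.
have hj : dot (u j) (y - v - r *: (x - v)) = (1 - r) * l.
  by move: rj; rewrite !dotE; lra.
move: (y - v - _) hi hj (subrK (r *: (x - v)) (y - v)) => X hi hj Xe.
(* If [mu] is nonzero, the two lines meet and a homothety is at work; otherwise the motion is a
   translation along both edges, which forces [r = 1]. *)
have [mu0|mu0] := eqVneq mu 0; last first.
  have cij : cross (u i) (u j) != 0.
    by apply: (@cross_facets _ _ _ facet_u _ _ ((- mu)^-1 *: w) ij);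
      rewrite dotZr (_ : dot _ _ = - mu) ?mulVf ?oppr_eq0//; lra.
  exists ((1 - r) * l / mu); first by field.
  rewrite -Xe addrC; congr (_ + _); apply: (dot_inj2 cij); rewrite ?hi ?hj !dotE.
    by rewrite (_ : dot (u i) w = - mu); [field|lra].
  by rewrite (_ : dot (u j) w = - mu); [field|lra].
have r1 : r = 1.
  apply/eqP/negPn/negP => r1.
  have rl : (1 - r) * l != 0 by apply: mulf_neq0; [rewrite subr_eq0 eq_sym|rewrite gt_eqF].
  have cij : cross (u i) (u j) != 0.
    by apply: (@cross_facets _ _ _ facet_u _ _ (((1 - r) * l)^-1 *: X) ij);
      rewrite dotZr ?hi ?hj mulVf.
  move/eqP: w0; apply; apply: (dot_inj2 cij); rewrite dot0r; lra.
have wi0 : dot (u i) w = 0 by lra.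
have ww := dot_gt0 w0.
have ciw : cross (u i) w != 0.
  have [z zi _] := facet_u i; apply/eqP => c0.
  by have := dot_dot_cross (u i) w z w; rewrite c0 zi wi0; lra.
exists (- (dot w X / dot w w)); first by rewrite mu0 r1; ring.
rewrite -Xe addrC; congr (_ + _); apply: (dot_inj2 ciw); rewrite ?hi !dotE.
  by rewrite wi0 r1; ring.
by field; lra.
Qed.

(** The segment from [p] to [q] lies in both final balls and meets the trajectory of [y] at a point
    [x]; the side of [x] on which [y] lies selects the ball. Edges moving outward retain [y] because
    the initial ball contains it, edges moving inward because they retain [x]. *)
Lemma slide_cover i j v l w mu p q T1 T2 y : i != j -> disjoint_edges i j ->
  0 < l -> w != 0 -> mu + dot (u i) w = 0 -> mu + dot (u j) w = 0 ->
  in_ball u v l p -> in_ball u v l q ->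
  dot (u i) (p - v) = l -> dot (u j) (q - v) = l ->
  0 <= T1 -> 0 <= T2 -> 0 < l + T2 * mu -> 0 < l + T1 * - mu ->
  in_ball u (v + T2 *: w) (l + T2 * mu) p -> in_ball u (v + T2 *: w) (l + T2 * mu) q ->
  in_ball u (v + T1 *: - w) (l + T1 * - mu) p ->
  in_ball u (v + T1 *: - w) (l + T1 * - mu) q ->
  in_ball u v l y ->
  in_ball u (v + T2 *: w) (l + T2 * mu) y \/ in_ball u (v + T1 *: - w) (l + T1 * - mu) y.
Proof.
move=> ij dj l0 w0 wi wj pv qv pi qj T1_ge0 T2_ge0 l2 l1 p2 q2 p1 q1 yv.
pose sg m z := l - dot (u m) (z - v).
have A0 : 0 < sg j p.
  rewrite subr_gt0 lt_neqAle pv andbT; apply/eqP => pj.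
  exact: (disjoint_edges_ball dj l0 pv).
have B0 : 0 < sg i q.
  rewrite subr_gt0 lt_neqAle qv andbT; apply/eqP => qi.
  exact: (disjoint_edges_ball dj l0 qv).
have si : 0 <= sg i y by rewrite subr_ge0.
have sj : 0 <= sg j y by rewrite subr_ge0.
set D := sg i y * sg j p + sg j y * sg i q.
have D0 : 0 < D.
  have [i0|i0] := eqVneq (sg i y) 0; last first.
    have si' : 0 < sg i y by rewrite lt_neqAle eq_sym i0.
    have h1 : 0 < sg i y * sg j p by rewrite mulr_gt0.
    have h2 : 0 <= sg j y * sg i q by rewrite mulr_ge0// ltW.
    by rewrite /D; lra.
  rewrite /D i0 mul0r add0r mulr_gt0// lt_neqAle sj eq_sym andbT.
  apply/eqP => j0; apply: (disjoint_edges_ball dj l0 yv).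
    by move: i0; rewrite /sg; lra.
  by move: j0; rewrite /sg; lra.
(* This weight gives [x] slacks at the edges [i] and [j] in the same ratio as those of [y]. *)
pose th := sg j y * sg i q / D.
have th0 : 0 <= th by rewrite divr_ge0 ?mulr_ge0 ?(ltW B0) ?(ltW D0).
have th1 : 0 <= 1 - th.
  by rewrite subr_ge0 ler_pdivrMr// mul1r /D lerDr mulr_ge0 ?(ltW A0).
pose x := th *: p + (1 - th) *: q.
have xE m a b : a - dot (u m) (x - b) =
    th * (a - dot (u m) (p - b)) + (1 - th) * (a - dot (u m) (q - b)).
  by rewrite /x !dotE; ring.
have [eta rl ye] : exists2 eta, D / (sg j p * sg i q) * l = l - eta * mu &
    y - v = (D / (sg j p * sg i q)) *: (x - v) - eta *: w.
  apply: (slide_decomposition ij l0 w0 wi wj); rewrite xE.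
    rewrite pi subrr mulr0 add0r -!/(sg _ _) /th /D; field.
    by rewrite -/D !gt_eqF.
  rewrite qj subrr mulr0 addr0 -!/(sg _ _) /th /D; field.
  by rewrite -/D !gt_eqF.
set r := D / _ in rl ye.
have r0 : 0 < r by rewrite divr_gt0// mulr_gt0.
have key m T : (l + T * mu) - dot (u m) (y - (v + T *: w)) =
    r * ((l + T * mu) - dot (u m) (x - (v + T *: w))) +
    eta * (l + T * mu) / l * (mu + dot (u m) w).
  have -> : y - (v + T *: w) = (y - v) - T *: w by rewrite opprD addrA.
  rewrite ye !dotE; have -> : r = (l - eta * mu) / l by rewrite -rl; field; lra.
  field; lra.
have [e0|e0] := leP eta 0; [left|right] => m.
  rewrite -subr_ge0; have [k0|k0] := leP 0 (mu + dot (u m) w).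
    by have := yv m; rewrite !dotE; nra.
  rewrite key xE addr_ge0//.
    by rewrite mulr_ge0 ?(ltW r0)// addr_ge0// mulr_ge0// subr_ge0.
  rewrite mulr_le0// ?(ltW k0)// ler_pdivrMr// mul0r mulr_le0_ge0//; exact: ltW.
rewrite mulrN scalerN -mulNr -scaleNr.
rewrite mulrN scalerN -mulNr -scaleNr in l1 p1 q1.
rewrite -subr_ge0; have [k0|k0] := leP (mu + dot (u m) w) 0.
  by have := yv m; rewrite !dotE; nra.
rewrite key xE addr_ge0//.
  by rewrite mulr_ge0 ?(ltW r0)// addr_ge0// mulr_ge0// subr_ge0.
by rewrite mulr_ge0 ?(ltW k0)// divr_ge0 ?(ltW l0)// mulr_ge0 ?ltW.
Qed.

End Sliding.

(** * Covering the unit ball by settled balls *)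

Lemma path_closed (R : realType) (v w : 'rV[R]_2) (l mu : R) (A : set ('rV[R]_2 * R)) :
  closed A -> closed [set s : R | A (v + s *: w, l + s * mu)].
Proof.
move=> cA; apply: (@preimage_closed _ _ (fun s : R => (v + s *: w, l + s * mu)) A) => //.
move=> s _.
have h1 : (v + t *: w) @[t --> nbhs s] --> v + s *: w.
  apply: (@cvgD _ _ _ (nbhs s)); first exact: cvg_cst.
  by apply: (@cvgZ _ _ _ (nbhs s)); [exact: cvg_id|exact: cvg_cst].
have h2 : (l + t * mu) @[t --> nbhs s] --> l + s * mu.
  apply: (@cvgD _ _ _ (nbhs s)); first exact: cvg_cst.
  by apply: (@cvgM _ _ (nbhs s)); [exact: cvg_id|exact: cvg_cst].
exact: (cvg_pair h1 h2).
Qed.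

Section Covering.
Variables (R : realType) (I : finType) (u : I -> 'rV[R]_2).
Hypotheses (bounded_u : bounded_gauge u) (facet_u : irredundant_gauge u).
Implicit Types (v w x y z p q : 'rV[R]_2) (l t : R) (Q : seq 'rV[R]_2).

Lemma in_ball_closed p : closed [set X : 'rV[R]_2 * R | in_ball u X.1 X.2 p].
Proof.
have -> : [set X : 'rV[R]_2 * R | in_ball u X.1 X.2 p] = \bigcap_(m in [set: I])
    [set X : 'rV[R]_2 * R | dot (u m) p <= dot (u m) X.1 + 1 * X.2].
  apply/seteqP; split=> -[v l] /= h m => [_|]; have := h m; rewrite /= !dotE; first lra.
  by move=> /(_ Logic.I); lra.
by apply: closed_bigI => m _; exact: closed_half_space.
Qed.

Definition corner Q v l i j q :=
  [/\ q \in Q, in_ball u v l q, dot (u i) (q - v) = l & dot (u j) (q - v) = l].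

Definition settled Q v l :=
  (exists i j k, [/\ i != j, i != k, j != k & [/\ touched u Q v l i,
     touched u Q v l j & touched u Q v l k]]) \/
  (exists q i j, i != j /\ corner Q v l i j q).

Lemma not_corner_on_edge Q v l i q : ~ settled Q v l -> q \in Q ->
  in_ball u v l q -> dot (u i) (q - v) = l -> on_edge u v l i q.
Proof.
move=> ns qQ qv qi; split=> // k ki; rewrite lt_neqAle qv andbT.
by apply/eqP => qk; apply: ns; right; exists q, k, i; split => //; split.
Qed.

(** The ball moves until the last time [T] up to which it stays admissible and keeps [p] and [q].
    There it must be settled, since otherwise it could move on. *)
Lemma slide Q v l i j p q w mu : admissible u Q v l -> 0 < l ->
  i != j -> disjoint_edges u i j -> w != 0 ->
  mu + dot (u i) w = 0 -> mu + dot (u j) w = 0 ->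
  p \in Q -> q \in Q -> on_edge u v l i p -> on_edge u v l j q ->
  exists2 t, 0 <= t & [/\ admissible u Q (v + t *: w) (l + t * mu), 0 < l + t * mu,
    in_ball u (v + t *: w) (l + t * mu) p, in_ball u (v + t *: w) (l + t * mu) q &
    settled Q (v + t *: w) (l + t * mu)].
Proof.
move=> adm l0 ij dj w0 wi wj pQ qQ pi qj.
pose A := [set X : 'rV[R]_2 * R | admissible u Q X.1 X.2] `&`
  ([set X | in_ball u X.1 X.2 p] `&` [set X | in_ball u X.1 X.2 q]).
have cA : closed A.
  apply: closedI; first exact: admissible_closed.
  by apply: closedI; exact: in_ball_closed.
pose G := [set s : R | A (v + s *: w, l + s * mu)].
have cG : closed G by exact: path_closed.
pose J := [set t : R | 0 <= t /\ forall s, 0 <= s <= t -> G s].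
have G0 : G 0.
  rewrite /G/= /A/= scale0r mul0r !addr0; split=> //; split=> m /=.
    exact: (on_edge_le _ pi).
  exact: (on_edge_le _ qj).
have J0 : J 0 by split=> // s; rewrite -eq_le => /eqP <-.
(* In an endless motion no edge moves inward and the radius does not shrink. If it grows,
   [- mu^-1 *: w] is a common point of two disjoint edges; if not, [- w] is a recession
   direction. *)
have ubJ : has_ubound J.
  apply: contrapT => nub.
  have Gt t : 0 <= t -> G t.
    move=> t0; apply: contrapT => nGt; apply: nub; exists t => s [s0 sG].
    by rewrite leNgt; apply/negP => ts; apply: nGt; apply: sG; rewrite t0 ltW.
  have k0 m : 0 <= mu + dot (u m) w.
    rewrite leNgt; apply/negP => k0.
    have c0 : 0 <= l - dot (u m) (p - v) by rewrite subr_ge0 (on_edge_le _ pi).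
    have : G ((l - dot (u m) (p - v) + 1) / - (mu + dot (u m) w)).
      by apply: Gt; rewrite divr_ge0//; lra.
    move=> [_ [/(_ m) + _]] /=; set t := _ / _.
    have : t * - (mu + dot (u m) w) = l - dot (u m) (p - v) + 1.
      by rewrite /t divfK//; lra.
    by rewrite !dotE /=; lra.
  have mu0 : 0 <= mu.
    rewrite leNgt; apply/negP => mu0.
    have : G ((l + 1) / - mu) by apply: Gt; rewrite divr_ge0//; lra.
    move=> [[+ _ _] _] /=; set t := _ / _.
    have : t * - mu = l + 1 by rewrite /t divfK//; lra.
    by move=> /= ? ?; lra.
  have [mu_gt0|mu_le0] := ltP 0 mu.
    apply: (dj (- mu^-1 *: w)).
    - by move=> m; have := k0 m; rewrite dotZr mulNr lerNl ler_pdivlMl//; lra.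
    - by rewrite dotZr (_ : dot (u i) w = - mu) ?mulrNN ?mulVf//; lra.
    - by rewrite dotZr (_ : dot (u j) w = - mu) ?mulrNN ?mulVf//; lra.
  move/eqP: w0; apply; apply/eqP; rewrite -oppr_eq0; apply/eqP.
  by apply: (recession bounded_u) => m; rewrite dotNr; have := k0 m; lra.
pose T := sup J.
have GT : G T.
  apply: cG => U UT; have [t [[t0 tG] tU]] := closure_sup (ex_intro _ 0 J0) ubJ UT.
  by exists t; split=> //; apply: tG; rewrite t0/=.
have T0 : 0 <= T by apply: ub_le_sup.
have GsT s : 0 <= s <= T -> G s.
  move=> /andP[s0]; rewrite le_eqVlt => /orP[/eqP->//|sT].
  have [t [t0 tG] st] := sup_gt (ex_intro _ 0 J0) sT.
  by apply: tG; rewrite s0 ltW.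
have [admT [pT qT]] := GT; rewrite /= in admT pT qT.
have piT : dot (u i) (p - (v + T *: w)) = l + T * mu.
  by move: pi.1; rewrite !dotE; nra.
have qjT : dot (u j) (q - (v + T *: w)) = l + T * mu.
  by move: qj.1; rewrite !dotE; nra.
(* At radius 0 both [p] and [q] would be the centre, but they lie on different edges. *)
have lT : 0 < l + T * mu.
  have [lT _ _] := admT; rewrite lt_neqAle lT eq_sym andbT; apply/eqP => lT0.
  have E r : in_ball u (v + T *: w) (l + T * mu) r -> r = v + T *: w.
    move=> rT; apply/eqP; rewrite -subr_eq0; apply/eqP.
    by apply: (recession bounded_u) => m; rewrite -lT0.
  have pq : p = q by rewrite (E p pT) (E q qT).
  by move/eqP: ij; apply; apply: (on_edge_inj qj); rewrite -pq; exact: pi.1.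
(* An unsettled ball would be touched only along [i] and [j], and neither of these edges leaves its
   line, so the motion would extend beyond [T]. *)
exists T => //; split=> //; apply: contrapT => ns.
have tch m : touched u Q (v + T *: w) (l + T * mu) m -> m = i \/ m = j.
  move=> tm; apply: contrapT => h; apply: ns; left; exists i, j, m; split=> //.
  - by apply/eqP => im; apply: h; left.
  - by apply/eqP => jm; apply: h; right.
  - by split=> //; right; [exists p|exists q].
have N1 := admissible_near admT lT (w := w) (mu := mu).
have {}N1 : \forall t \near (0 : R)^'+,
    admissible u Q (v + T *: w + t *: w) (l + T * mu + t * mu).
  by apply: N1 => m /tch[->|->]; rewrite ?wi ?wj.
have N2 := on_edge_near (not_corner_on_edge ns pQ pT piT) wi.
have N3 := on_edge_near (not_corner_on_edge ns qQ qT qjT) wj.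
have [e e0 he] : exists2 e : R, 0 < e & forall t, 0 < t <= e -> G (T + t).
  apply: at_right0_ex; move: N1 N2 N3; apply: filterS3 => t h1 h2 h3.
  rewrite /G/= scalerDl mulrDl !addrA; split=> //=.
  by split=> m; [exact: (on_edge_le _ h2)|exact: (on_edge_le _ h3)].
have : J (T + e).
  split=> [|s /andP[s0 se]]; first by lra.
  have [sT|sT] := leP s T; first by apply: GsT; rewrite s0.
  by rewrite -(subrKC T s); apply: he; apply/andP; split; lra.
by move=> /(ub_le_sup ubJ); rewrite -/T; lra.
Qed.

(** For an edge touched by a site this is immediate; for an edge lying on a wall it supplies a site
    there as soon as a second edge is touched. *)
Definition wall_sites Q := forall v l i j, admissible u Q v l -> 0 < l -> i != j ->
  touched u Q v l i -> touched u Q v l j ->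
  exists q, [/\ q \in Q, in_ball u v l q & dot (u i) (q - v) = l].

Lemma settled_cover Q x : wall_sites Q -> (forall m, dot (u m) x <= 1) ->
  exists v l, [/\ admissible u Q v l, 0 < l, settled Q v l & in_ball u v l x].
Proof.
move=> wQ xC; have [v0 [l0 [l0_gt0 adm0 x0]]] := start_ball bounded_u facet_u Q xC.
have [] := @max_radius _ _ _ bounded_u Q _ (@in_ball_closed x).
  by exists v0, l0.
move=> v [l [adm xv mx]]; rewrite /= in xv.
have l_gt0 : 0 < l by apply: lt_le_trans (mx _ _ adm0 x0).
have [|ns] := pselect (settled Q v l); first by exists v, l.
(* Passing to radius [l + t] and centre [v - t *: y] moves no edge inward, so [x] is kept, and fixes
   the lines of the touched edges. This contradicts maximality. *)
have grow y : (forall m, dot (u m) y <= 1) ->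
    (forall m, touched u Q v l m -> dot (u m) y = 1) -> False.
  move=> yC yt.
  have [e e0 he] : exists2 e : R, 0 < e & forall t, 0 < t <= e ->
      admissible u Q (v + t *: - y) (l + t * 1).
    apply: at_right0_ex; apply: admissible_near => // m /yt ym.
    by rewrite dotNr ym subrr.
  have := mx _ _ (he e _); rewrite lexx e0 => /(_ isT) h.
  suff /h : in_ball u (v + e *: - y) (l + e * 1) x by lra.
  by move=> m; have := xv m; have := yC m; rewrite !dotE; nra.
have [[i [j [ij ti tj]]]|nt] := pselect (exists i j,
    [/\ i != j, touched u Q v l i & touched u Q v l j]); last first.
  exfalso.
  have [i hi] : exists i, forall m, touched u Q v l m -> m = i.
    have [[i ti]|h] := pselect (exists i, touched u Q v l i).
      exists i => m tm; apply/eqP/negPn/negP => mi; apply: nt; exists m, i.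
      by split.
    have [i] := facet_exists bounded_u; exists i => m tm; exfalso; apply: h.
    by exists m.
  have [z zi zk] := facet_u i; apply: (grow z) => [m|m /hi->//].
  by have [->|/zk/ltW//] := eqVneq m i; rewrite zi.
have tch m : touched u Q v l m -> m = i \/ m = j.
  move=> tm; apply: contrapT => h; apply: ns; left; exists i, j, m; split=> //.
  - by apply/eqP => im; apply: h; left.
  - by apply/eqP => jm; apply: h; right.
have dj : disjoint_edges u i j.
  by move=> y yC yi yj; apply: (grow y) => // m /tch[->|->].
have [p [pQ pv pi]] := wQ _ _ _ _ adm l_gt0 ij ti tj.
have [q [qQ qv qj]] : exists q, [/\ q \in Q, in_ball u v l q & dot (u j) (q - v) = l].
  by apply: (wQ _ _ j i adm l_gt0 _ tj ti); rewrite eq_sym.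
have Dp := not_corner_on_edge ns pQ pv pi.
have Dq := not_corner_on_edge ns qQ qv qj.
(* Up to scaling, this is the only motion that keeps the edges [i] and [j] on their lines. *)
pose w := perp (u j - u i); pose mu := - cross (u j) (u i).
have wi : mu + dot (u i) w = 0 by rewrite dot_perp /mu /cross !mxE; ring.
have wj : mu + dot (u j) w = 0 by rewrite dot_perp /mu /cross !mxE; ring.
have w0 : w != 0.
  apply/eqP => w0; have [z zi /(_ j)] := facet_u i; rewrite eq_sym => /(_ ij).
  rewrite -zi; suff -> : u j = u i by rewrite ltxx.
  apply/eqP; rewrite -subr_eq0; apply/eqP; apply: row2P.
    by have /rowP/(_ 1) := w0; rewrite /w /perp !mxE.
  by have /rowP/(_ 0) := w0; rewrite /w /perp !mxE /=; lra.
have [T2 T2_ge0 [a2 l2 p2 q2 s2]] := slide adm l_gt0 ij dj w0 wi wj pQ qQ Dp Dq.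
have w0' : - w != 0 by rewrite oppr_eq0.
have wi' : - mu + dot (u i) (- w) = 0 by rewrite dotNr; lra.
have wj' : - mu + dot (u j) (- w) = 0 by rewrite dotNr; lra.
have [T1 T1_ge0 [a1 l1 p1 q1 s1]] := slide adm l_gt0 ij dj w0' wi' wj' pQ qQ Dp Dq.
have [h|h] := slide_cover facet_u ij dj l_gt0 w0 wi wj pv qv pi qj T1_ge0
  T2_ge0 l2 l1 p2 q2 p1 q1 xv.
  by exists (v + T2 *: w), (l + T2 * mu).
by exists (v + T1 *: - w), (l + T1 * - mu).
Qed.

End Covering.

(** * Counting *)

(** This bounds a family of balls by the number of signatures, once each signature determines at
    most one ball. *)
Lemma functional_relation_image (A T : eqType) (s : seq A) (rel : A -> T -> Prop) :
  (forall a D D', rel a D -> rel a D' -> D = D') ->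
  exists F : seq T, [/\ (size F <= size s)%N,
    forall D, D \in F -> exists2 a, a \in s & rel a D &
    forall a D, a \in s -> rel a D -> D \in F].
Proof.
move=> uniq_rel; elim: s => [|a s [F [sF Fs sF']]]; first by exists [::].
have [[D aD]|na] := pselect (exists D, rel a D).
  exists (D :: F); split=> [|D'|b D']; rewrite ?inE //.
    by move=> /orP[/eqP->|/Fs[b bs bD']]; [exists a|exists b];
      rewrite ?inE ?eqxx ?bs ?orbT.
  move=> /orP[/eqP->|bs] bD'; first by rewrite (uniq_rel _ _ _ bD' aD) eqxx.
  by rewrite (sF' _ _ bs bD') orbT.
exists F; split=> [|D' /Fs[b bs bD']|b D']; first exact: leqW.
  by exists b => //; rewrite inE bs orbT.
rewrite inE => /orP[/eqP-> aD'|bs bD']; last exact: sF' bs bD'.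
by case: na; exists D'.
Qed.

Lemma seq_avoid (R : realType) (s : seq R) : exists t, t \notin s.
Proof.
suff [t ht] : exists t, forall x, x \in s -> x < t.
  by exists t; apply/negP => /ht; rewrite ltxx.
elim: s => [|a s [t ht]]; first by exists 0.
exists (Num.max t (a + 1)) => x; rewrite inE => /orP[/eqP->|/ht xt].
  by rewrite lt_max; apply/orP; right; lra.
by rewrite lt_max xt.
Qed.

(** The functional [(1, t)] identifies two distinct points for at most one [t], and finitely many
    values can be avoided. *)
Lemma injective_functional (R : realType) (Q : seq 'rV[R]_2) :
  exists f, {in Q &, injective (dot f)}.
Proof.
pose slope (p q : 'rV[R]_2) := - (p 0 0 - q 0 0) / (p 0 1 - q 0 1).
have [t ht] := seq_avoid [seq slope p q | p <- Q, q <- Q].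
exists (\row_k (if k == 0 then 1 else t)) => p q pQ qQ; rewrite /dot !mxE /= => e.
have e1 : p 0 1 = q 0 1.
  apply/eqP/negPn/negP => pq; move/negP: ht; apply; apply/allpairsP.
  exists (p, q); split => //=; rewrite /slope.
  have pq' : p 0 1 - q 0 1 != 0 by rewrite subr_eq0.
  by apply: (mulIf pq'); rewrite divfK//; lra.
by apply: row2P => //; move: e; rewrite e1; lra.
Qed.

Section Counting.
Variables (R : realType) (I : finType) (u : I -> 'rV[R]_2).
Hypotheses (bounded_u : bounded_gauge u) (facet_u : irredundant_gauge u).
Implicit Types (v w x y z p q : 'rV[R]_2) (l t : R) (P Q : seq 'rV[R]_2).

(** [Q] adds to [P] the vertices of the unit ball, for balls on two walls, and boundedly many wall
    points for each point of [P], for balls touching a wall and that point. A nonempty [P] absorbs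
    the vertices into the linear bound. *)
Lemma wall_sites_exist : exists N : nat, forall P, P != [::] ->
  (forall p, p \in P -> forall m, dot (u m) p < 1) ->
  exists Q, [/\ (size Q <= N * size P)%N, {subset P <= Q} & wall_sites u Q].
Proof.
pose vert (a : I * I) y := [/\ a.1 != a.2, forall m, dot (u m) y <= 1,
  dot (u a.1) y = 1 & dot (u a.2) y = 1].
have [W1 [_ W1v vW1]] : exists F : seq 'rV[R]_2, [/\ (size F <= size (enum {: I * I}))%N,
    forall y, y \in F -> exists2 a, a \in enum {: I * I} & vert a y &
    forall a y, a \in enum {: I * I} -> vert a y -> y \in F].
  apply: functional_relation_image => a y y' [ne _ h1 h2] [_ _ h1' h2'].
  exact: (vertex_uniq facet_u ne).
have /choice[K hK] : forall a : I * I, exists K : seq 'rV[R]_2, a.1 != a.2 ->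
    (forall k, k \in K -> dot (u a.2) k = 1) /\
    forall y, (forall m, dot (u m) y <= 1) -> dot (u a.1) y = 1 -> dot (u a.2) y < 1 ->
    exists2 k, k \in K & forall m, dot (u m) (y + (1 - dot (u a.2) y) *: k) <= 1.
  move=> a.
  have [e|ne] := eqVneq a.1 a.2; first by exists [::].
  by have [K hK] := wall_directions bounded_u facet_u ne; exists K.
pose L := [seq (a, k) | a <- enum {: I * I}, k <- [seq k <- K a | a.1 != a.2]].
pose wall p (b : I * I * 'rV[R]_2) := p + (1 - dot (u b.1.2) p) *: b.2.
exists (1 + size W1 + size L)%N => P P0 Pint.
exists (P ++ W1 ++ [seq wall p b | p <- P, b <- L]); split.
- rewrite !size_cat size_allpairs !mulnDl mul1n -addnA leq_add2l leq_add//.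
    by rewrite leq_pmulr// lt0n size_eq0.
  by rewrite mulnC.
- by move=> p pP; rewrite mem_cat pP.
set Q := _ ++ _.
have QP q : q \in Q -> q \in P \/ exists j, dot (u j) q = 1.
  rewrite !mem_cat => /or3P[qP|/W1v[a _ [_ _ a1 _]]|]; [by left|by right; exists a.1|].
  move=> /allpairsP[[p b] /= [pP /allpairsPdep[a [k [_ + bE]]] ->]].
  rewrite mem_filter => /andP[ne ka]; right; exists a.2; rewrite /wall bE /= !dotE.
  by have [/(_ k ka)-> _] := hK a ne; ring.
have W1Q v l i j : admissible u Q v l -> 0 < l -> i != j ->
    dot (u i) v + l = 1 -> dot (u j) v + l = 1 ->
    exists q, [/\ q \in Q, in_ball u v l q & dot (u i) (q - v) = l].
  move=> [_ wallv site] l0 ij vi vj.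
  have l1 : l < 1.
    rewrite ltNge; apply/negP => l1.
    have v0 : v = 0 by apply: (recession bounded_u) => m; have := wallv m; lra.
    case: P P0 Pint @Q QP site => // p P _ /(_ p (mem_head _ _)) pint Q QP.
    move=> /(_ p); rewrite mem_cat mem_head => /(_ isT)[m].
    by rewrite v0 subr0; have := pint m; lra.
  (* Being on two walls, the ball is the image of the unit ball under a homothety centred at the
     vertex [y], which is a site. *)
  pose y := (1 - l)^-1 *: v.
  have yC m : dot (u m) y <= 1.
    by rewrite dotZr ler_pdivrMl ?mulr1; have := wallv m; lra.
  have yi : dot (u i) y = 1.
    by rewrite dotZr (_ : dot (u i) v = 1 - l) ?mulVf//; lra.
  have yj : dot (u j) y = 1.
    by rewrite dotZr (_ : dot (u j) v = 1 - l) ?mulVf//; lra.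
  have vE : v = (1 - l) *: y by rewrite /y scalerA divff ?scale1r//; lra.
  move: y yC yi yj vE => y yC yi yj vE; exists y; split.
  - rewrite !mem_cat; apply/or3P/Or32/(vW1 (i, j)); first by rewrite mem_enum.
    by split.
  - by move=> m; rewrite vE !dotE; have := yC m; nra.
  - by rewrite vE !dotE yi; ring.
have W2Q v l i j p : admissible u Q v l -> 0 < l -> i != j ->
    dot (u i) v + l = 1 -> p \in P -> in_ball u v l p -> dot (u j) (p - v) = l ->
    exists q, [/\ q \in Q, in_ball u v l q & dot (u i) (q - v) = l].
  move=> adm l0 ij vi pP pv pj.
  have [pi|pi] := eqVneq (dot (u i) (p - v)) l.
    by exists p; split=> //; rewrite mem_cat pP.
  have ji : j != i by rewrite eq_sym.
  have [Ki hKi] := hK (j, i) ji.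
  pose y := l^-1 *: (p - v).
  have yE m : l * dot (u m) y = dot (u m) (p - v) by rewrite dotZr mulVKf//; lra.
  (* By this identity the wall site reached from [p] depends on [p] and the direction, but not on
     the ball. *)
  have yi : l * (1 - dot (u i) y) = 1 - dot (u i) p.
    by rewrite mulrBr yE !dotE; lra.
  move: y yE yi => y yE yi.
  have [k kK hk] : exists2 k, k \in K (j, i) &
      forall m, dot (u m) (y + (1 - dot (u i) y) *: k) <= 1.
    apply: hKi => /=.
    - by move=> m; rewrite -(ler_pM2l l0) yE mulr1; exact: pv.
    - by apply: (mulfI (lt0r_neq0 l0)); rewrite yE pj mulr1.
    - by rewrite -(ltr_pM2l l0) yE mulr1 lt_neqAle pi; exact: pv.
  have dE m : dot (u m) (wall p ((j, i), k) - v) =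
      l * dot (u m) (y + (1 - dot (u i) y) *: k).
    by rewrite [in RHS]dotDr mulrDr yE dotZr mulrA yi /wall /= !dotE; ring.
  exists (wall p ((j, i), k)); split.
  - rewrite !mem_cat; apply/or3P/Or33/allpairsP.
    exists (p, ((j, i), k)); split=> //=; apply/allpairsPdep.
    by exists (j, i), k; split => //; rewrite ?mem_enum// mem_filter ji.
  - by move=> m; rewrite dE -[leRHS]mulr1 ler_pM2l.
  - by have /= kj := Ki k kK; rewrite dE dotDr dotZr kj; ring.
move=> v l i j adm l0 ij [vi|]; last by move=> [q [? ? ?]] _; exists q.
(* A site on a wall can belong to the ball only if the ball touches that wall, so the wall replaces
   it as an obstacle. *)
have onwall q k : q \in Q -> in_ball u v l q -> dot (u k) q = 1 ->
    dot (u k) v + l = 1 /\ dot (u k) (q - v) = l.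
  move=> qQ qv qk; have [_ /(_ k) wk _] := adm; have := qv k.
  by rewrite !dotE qk; split; lra.
move=> [vj|[q [qQ qv qj]]]; first exact: (W1Q v l i j).
have [qP|[k qk]] := QP q qQ; first exact: (W2Q v l i j q).
have [vk qvk] := onwall q k qQ qv qk.
have [ki|ki] := eqVneq k i; first by exists q; split; rewrite -?ki.
by apply: (W1Q v l i k) => //; rewrite eq_sym.
Qed.

(** Both balls have [q] at the same vertex position, so they are homothetic with centre [q] and
    nested according to their radii. *)
Lemma corner_subball Q v l v' l' i j q : i != j -> 0 < l -> l <= l' ->
  corner u Q v l i j q -> corner u Q v' l' i j q ->
  forall x, in_ball u v l x -> in_ball u v' l' x.
Proof.
move=> ij l0 ll' [_ qv qi qj] [_ qv' qi' qj'] x xv m.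
have l'0 : 0 < l' by exact: lt_le_trans ll'.
pose y := l^-1 *: (q - v); pose y' := l'^-1 *: (q - v').
have yy' : y = y'.
  apply: (vertex_uniq facet_u ij); rewrite dotZr ?qi ?qj ?qi' ?qj' mulVf//; lra.
have ym : dot (u m) y <= 1 by rewrite dotZr ler_pdivrMl// mulr1; exact: qv.
have e : l * dot (u m) y = dot (u m) q - dot (u m) v.
  by rewrite dotZr mulVKf ?dotE//; lra.
have e' : l' * dot (u m) y = dot (u m) q - dot (u m) v'.
  by rewrite yy' dotZr mulVKf ?dotE//; lra.
by have := xv m; rewrite !dotE; nra.
Qed.

Lemma corner_uniq Q v l v' i j q : i != j -> 0 < l ->
  corner u Q v l i j q -> corner u Q v' l i j q -> v = v'.
Proof.
move=> ij l0 [_ _ qi qj] [_ _ qi' qj'].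
have : l^-1 *: (q - v) = l^-1 *: (q - v').
  by apply: (vertex_uniq facet_u ij); rewrite dotZr ?qi ?qj ?qi' ?qj' mulVf//; lra.
move=> e; have l'0 : l^-1 != 0 by rewrite invr_eq0 gt_eqF.
by apply: oppr_inj; apply: (addrI q); exact: (scalerI l'0 e).
Qed.

Lemma maximal_corner Q v l i j q : admissible u Q v l -> corner u Q v l i j q ->
  exists v' l', [/\ admissible u Q v' l', corner u Q v' l' i j q, l <= l' &
    forall v'' l'', admissible u Q v'' l'' -> corner u Q v'' l'' i j q -> l'' <= l'].
Proof.
move=> adm cv.
(* For a site in the ball, each edge equality reduces to one inequality, which is a closed
   half-space. *)
pose A := [set X : 'rV[R]_2 * R | in_ball u X.1 X.2 q] `&`
  ([set X : 'rV[R]_2 * R | - dot (u i) q <= dot (- u i) X.1 + (-1) * X.2] `&`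
   [set X : 'rV[R]_2 * R | - dot (u j) q <= dot (- u j) X.1 + (-1) * X.2]).
have cA : closed A.
  apply: closedI; first exact: in_ball_closed.
  by apply: closedI; exact: closed_half_space.
have AE v' l' : A (v', l') <-> corner u Q v' l' i j q.
  have [qQ _ _ _] := cv; rewrite /A /= /dot !mxE; split=> [[qv [qi qj]]|[_ qv qi qj]].
    split=> //; apply/eqP; rewrite eq_le qv/=.
      by move: qi; rewrite /dot !mxE; lra.
    by move: qj; rewrite /dot !mxE; lra.
  split=> //; split; [move: qi|move: qj]; rewrite /dot !mxE; lra.
have [|v' [l' [adm' /AE cv' mx]]] := max_radius bounded_u cA (Q := Q).
  by exists v, l; split=> //; apply/AE.
exists v', l'; split=> //; first by apply: (mx v l) => //; apply/AE.
by move=> v'' l'' h /AE; exact: mx.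
Qed.

Definition corner_signature Q (a : 'rV[R]_2 * (I * I)) (D : 'rV[R]_2 * R) :=
  [/\ a.2.1 != a.2.2, 0 < D.2, admissible u Q D.1 D.2,
   corner u Q D.1 D.2 a.2.1 a.2.2 a.1 & forall v l, admissible u Q v l ->
     corner u Q v l a.2.1 a.2.2 a.1 -> l <= D.2].

(** The edges are listed as that of the middle site, then those of the sites with smaller and with
    larger value of [f]. *)
Definition middle_signature Q f (a : 'rV[R]_2 * (I * I * I)) (D : 'rV[R]_2 * R) :=
  let i := a.2.1.1 in let j := a.2.1.2 in let k := a.2.2 in
  [/\ [/\ j != i, k != i & j != k], 0 < D.2, admissible u Q D.1 D.2 &
    exists q r, [/\ q \in Q, r \in Q, on_edge u D.1 D.2 i a.1 &
      [/\ on_edge u D.1 D.2 j q, on_edge u D.1 D.2 k r &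
       dot f q < dot f a.1 < dot f r]]].

Lemma corner_signature_uniq Q a D D' :
  corner_signature Q a D -> corner_signature Q a D' -> D = D'.
Proof.
case: D D' => [v l] [v' l'] [/= ij l0 adm cv mx] [_ l'0 adm' cv' mx'].
have ll' : l = l' by apply/eqP; rewrite eq_le (mx' v l)//= (mx v' l').
by subst l'; rewrite (corner_uniq ij l0 cv cv').
Qed.

Lemma middle_signature_uniq Q f a D D' :
  middle_signature Q f a D -> middle_signature Q f a D' -> D = D'.
Proof.
case: D D' a => [v l] [v' l'] [p [[i j] k]] [/= [ji ki jk] l0 [_ _ adm]].
move=> [q [r [qQ rQ Dp [Dq Dr f1]]]] [_ l'0 [_ _ adm']].
move=> [q' [r' [q'Q r'Q D'p [D'q' D'r' f2]]]].
by have [-> ->] := noncrossing l0 l'0 ji ki jk Dp D'p Dq D'q' Dr D'r'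
  (adm' _ qQ) (adm' _ rQ) (adm _ q'Q) (adm _ r'Q) f1 f2.
Qed.

Lemma middle_exists (T : Type) (f : T -> R) (a b c : I * T) :
  a.1 != b.1 -> a.1 != c.1 -> b.1 != c.1 ->
  f a.2 != f b.2 -> f a.2 != f c.2 -> f b.2 != f c.2 ->
  forall X : I * T -> Prop, X a -> X b -> X c ->
  exists d e g, [/\ X d, X e, X g,
    [/\ e.1 != d.1, g.1 != d.1 & e.1 != g.1] & f e.2 < f d.2 < f g.2].
Proof.
move=> ab ac bc fab fac fbc X Xa Xb Xc.
have ba : b.1 != a.1 by rewrite eq_sym.
have ca : c.1 != a.1 by rewrite eq_sym.
have cb : c.1 != b.1 by rewrite eq_sym.
have [lab|lab|e] := ltgtP (f a.2) (f b.2); last by rewrite e eqxx in fab.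
- have [lbc|lbc|e] := ltgtP (f b.2) (f c.2); last by rewrite e eqxx in fbc.
    by exists b, a, c; split=> //; rewrite lab.
  have [lac|lac|e] := ltgtP (f a.2) (f c.2); last by rewrite e eqxx in fac.
    by exists c, a, b; split=> //; rewrite lac.
  by exists a, c, b; split=> //; rewrite lac.
have [lac|lac|e] := ltgtP (f a.2) (f c.2); last by rewrite e eqxx in fac.
  by exists a, b, c; split=> //; rewrite lab.
have [lbc|lbc|e] := ltgtP (f b.2) (f c.2); last by rewrite e eqxx in fbc.
  by exists c, b, a; split=> //; rewrite lbc.
by exists b, c, a; split=> //; rewrite lbc.
Qed.

Lemma settled_signature Q f v l : wall_sites u Q -> {in Q &, injective (dot f)} ->
  admissible u Q v l -> 0 < l -> settled u Q v l ->
  exists D, ((exists2 a, a.1 \in Q & corner_signature Q a D) \/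
             (exists2 a, a.1 \in Q & middle_signature Q f a D)) /\
    forall x, in_ball u v l x -> in_ball u D.1 D.2 x.
Proof.
move=> wQ finj adm l0 st.
(* Corners are tested first, so that in the remaining case every site on an edge lies in its
   relative interior, as the noncrossing argument requires. *)
have [[q [i [j [ij cv]]]]|nc] := pselect (exists q i j, i != j /\ corner u Q v l i j q).
  have [v' [l' [adm' cv' ll' mx]]] := maximal_corner adm cv.
  exists (v', l'); split=> /=; last exact: corner_subball cv cv'.
  left; exists (q, (i, j)) => /=; first by case: cv.
  by split=> //=; exact: lt_le_trans ll'.
case: st => [[i [j [k [ij ik jk [ti tj tk]]]]]|//].
exists (v, l); split=> //; right.
have site i' j' : i' != j' -> touched u Q v l i' -> touched u Q v l j' ->
    exists2 q, q \in Q & on_edge u v l i' q.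
  move=> ij' ti' tj'; have [q [qQ qv qi]] := wQ _ _ _ _ adm l0 ij' ti' tj'.
  exists q => //; split=> // k' ki'; rewrite lt_neqAle qv andbT; apply/eqP => qk.
  by apply: nc; exists q, k', i'; split=> //; split.
have ji : j != i by rewrite eq_sym.
have ki : k != i by rewrite eq_sym.
have [a aQ ai] := site _ _ ij ti tj.
have [b bQ bj] := site j i ji tj ti.
have [c cQ ck] := site k i ki tk ti.
have neq i' j' p q : i' != j' -> p \in Q -> q \in Q -> on_edge u v l i' p ->
    on_edge u v l j' q -> dot f p != dot f q.
  move=> ij' pQ qQ pi qj; apply: contra_neq ij' => /(finj _ _ pQ qQ) pq.
  by apply: (on_edge_inj qj); rewrite -pq; case: pi.
have [[i1 p] [[i2 q] [[i3 r] /= [[pQ pi] [qQ qi] [rQ ri] ne fpqr]]]] :=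
  @middle_exists _ (dot f) (i, a) (j, b) (k, c) ij ik jk (neq _ _ _ _ ij aQ bQ ai bj)
  (neq _ _ _ _ ik aQ cQ ai ck) (neq _ _ _ _ jk bQ cQ bj ck)
  (fun d : I * _ => d.2 \in Q /\ on_edge u v l d.1 d.2) (conj aQ ai) (conj bQ bj) (conj cQ ck).
exists (p, (i1, i2, i3)) => //; split=> //.
by exists q, r; split.
Qed.

Theorem unit_ball_cover : exists N : nat, forall P, P != [::] ->
  (forall p, p \in P -> forall m, dot (u m) p < 1) ->
  exists F : seq ('rV[R]_2 * R), [/\ (size F <= N * size P)%N,
    forall D, D \in F -> [/\ 0 < D.2, forall m, dot (u m) D.1 + D.2 <= 1 &
      forall p, p \in P -> exists m, D.2 <= dot (u m) (p - D.1)] &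
    forall x, (forall m, dot (u m) x <= 1) -> exists2 D, D \in F & in_ball u D.1 D.2 x].
Proof.
have [N hN] := wall_sites_exist.
(* The old [N] bounds the number of sites per point of [P]; pairs of edges label the corners, and
   triples label the edges of three sites. *)
exists (N * (#|{: I * I}| + #|{: I * I * I}|))%N => P P0 Pint.
have [Q [sQ PQ wQ]] := hN P P0 Pint; have [f finj] := injective_functional Q.
have [F1 [sF1 F1Q QF1]] := functional_relation_image
  [seq (q, a) | q <- Q, a <- enum {: I * I}] (@corner_signature_uniq Q).
have [F2 [sF2 F2Q QF2]] := functional_relation_image
  [seq (q, a) | q <- Q, a <- enum {: I * I * I}] (@middle_signature_uniq Q f).
exists (F1 ++ F2); split.
- rewrite size_cat mulnAC; apply: leq_trans (leq_mul sQ (leqnn _)).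
  by move: sF1 sF2; rewrite !size_allpairs -!cardE mulnDr; exact: leq_add.
- move=> D; rewrite mem_cat => /orP[/F1Q[a _ [_ D0 [_ h1 h2] _ _]]|/F2Q[a _ [_ D0 [_ h1 h2] _]]];
  by split=> // p /PQ; exact: h2.
move=> x /(settled_cover bounded_u facet_u wQ)[v [l [adm l0 st xv]]].
have [D [hD vD]] := settled_signature wQ finj adm l0 st.
exists D; last exact: vD.
rewrite mem_cat; case: hD => -[[p a] pQ hD]; apply/orP; [left|right].
  by apply: QF1 hD; apply/allpairsP; exists (p, a); rewrite mem_enum.
by apply: QF2 hD; apply/allpairsP; exists (p, a); rewrite mem_enum.
Qed.

End Counting.

(** * Polygons as intersections of half-planes *)

Lemma seq_max (R : realDomainType) (s : seq R) x : x \in s ->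
  exists2 t, t \in s & forall a, a \in s -> a <= t.
Proof.
elim: s x => // b s IH x _; have [->|s0] := eqVneq s [::].
  by exists b; rewrite ?mem_head// => a; rewrite inE => /eqP->.
have [|t ts ht] := IH (head x s); first by case: s s0 {IH} => // ? ? _; exact: mem_head.
have [bt|tb] := leP b t.
  by exists t; rewrite ?inE ?ts ?orbT// => a; rewrite inE => /orP[/eqP->|/ht].
exists b; rewrite ?mem_head// => a; rewrite inE => /orP[/eqP->//|/ht at_].
by apply: le_trans at_ (ltW tb).
Qed.

Section HalfPlanes.
Variable R : realType.
Implicit Types (a d w x y z : 'rV[R]_2) (L : seq ('rV[R]_2 * R)).
Implicit Types (E : seq ('rV[R]_2 * R * R)).

Lemma row_entry_norm x k : `|x 0 k| <= `|x|.
Proof.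
rewrite [leRHS]mx_normrE; apply/bigmax_geP; right.
by exists (0, k).
Qed.

Definition half_planes L : set 'rV[R]_2 :=
  [set y | forall h, h \in L -> dot h.1 y <= h.2].

(* An entry [(w, b, c)] of [E] stands for [dot w y + t * c <= b], and the
   variable [t] is eliminated. *)
Definition eliminate E : seq ('rV[R]_2 * R) :=
  [seq h.1 | h <- E & h.2 == 0] ++
  [seq (- h'.2 *: h.1.1 + h.2 *: h'.1.1, - h'.2 * h.1.2 + h.2 * h'.1.2) |
     h <- [seq h <- E | 0 < h.2], h' <- [seq h <- E | h.2 < 0]].

(** The largest lower bound on [t], which exists because of [h0], is a witness; the combined rows
    say that it is at most each upper bound. *)
Lemma fourier_motzkin E y h0 : h0 \in E -> h0.2 < 0 ->
  half_planes (eliminate E) y <->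
  exists t, forall h, h \in E -> dot h.1.1 y + t * h.2 <= h.1.2.
Proof.
move=> h0E h0neg; split=> [hy|[t ht] h]; last first.
  rewrite mem_cat => /orP[/mapP[h1]|/allpairsP[[h1 h2]] /=].
    by rewrite mem_filter => /andP[/eqP h10 /ht +] ->; rewrite h10; lra.
  rewrite !mem_filter => -[/andP[h10 /ht e1] /andP[h20 /ht e2] ->] /=.
  by rewrite dotDl !dotZl; nra.
pose low (h : 'rV[R]_2 * R * R) := (h.1.2 - dot h.1.1 y) / h.2.
have [t /mapP[h1 h1E tE] ht] : exists2 t, t \in [seq low h | h <- E & h.2 < 0] &
    forall b : R, b \in [seq low h | h <- E & h.2 < 0] -> b <= t.
  by apply: (@seq_max _ _ (low h0)); apply: map_f; rewrite mem_filter h0neg.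
move: h1E; rewrite mem_filter => /andP[h1neg h1E].
have t1 : t * h1.2 = h1.1.2 - dot h1.1.1 y by rewrite tE /low divfK// lt_eqF.
exists t => h hE; have [h_neg|h_pos|h_0] := ltgtP h.2 0.
- have : low h <= t by apply: ht; apply: map_f; rewrite mem_filter h_neg.
  by rewrite /low ler_ndivrMr//; lra.
- have := hy (- h1.2 *: h.1.1 + h.2 *: h1.1.1, - h1.2 * h.1.2 + h.2 * h1.1.2).
  rewrite mem_cat orbC; set b := _ \in allpairs _ _ _.
  have -> : b by apply/allpairsP; exists (h, h1); rewrite !mem_filter h_pos h1neg hE h1E.
  rewrite /= dotDl !dotZl => /(_ isT) e.
  have : - h1.2 * (dot h.1.1 y + t * h.2) <= - h1.2 * h.1.2 by nra.
  by rewrite ler_pM2l//; lra.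
- rewrite h_0 mulr0 addr0; apply: (hy h.1).
  by rewrite mem_cat; apply/orP; left; apply: map_f; rewrite mem_filter h_0 eqxx.
Qed.

Lemma bounded_recession L y0 M d : half_planes L y0 ->
  (forall y, half_planes L y -> forall k, `|y 0 k| <= M) ->
  (forall h, h \in L -> dot h.1 d <= 0) -> d = 0.
Proof.
move=> y0L hM hd; apply/rowP => k; rewrite mxE.
apply/eqP/negPn/negP => dk; have ndk : 0 < `|d 0 k| by rewrite normr_gt0.
have M0 : 0 <= M by apply: le_trans (hM _ y0L k).
pose s := (M + `|y0 0 k| + 1) / `|d 0 k|.
have s0 : 0 <= s by rewrite divr_ge0//; have := normr_ge0 (y0 0 k); lra.
have : `|(y0 + s *: d) 0 k| <= M.
  by apply: hM => h hL; rewrite !dotE; have := y0L h hL; have := hd h hL; nra.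
have sdk : `|s * d 0 k| = M + `|y0 0 k| + 1.
  by rewrite normrM ger0_norm// /s divfK// gt_eqF.
have := ler_normD (y0 0 k + s * d 0 k) (- y0 0 k).
by rewrite !mxE addrAC subrr add0r normrN sdk; lra.
Qed.

Lemma half_planes_convex L : convex_set (half_planes L).
Proof.
move=> x y t; rewrite !inE => hx hy h hL.
have -> : conv t x y = t%:num *: (x : 'rV[R]_2) + (1 - t%:num) *: (y : 'rV[R]_2) by [].
have := hx h hL; have := hy h hL; rewrite !dotE.
have : 0 <= t%:num by []. 
have : t%:num <= 1 by [].
nra.
Qed.

(** By induction on the points: the join of a polyhedron with [a] is the projection of a polyhedron
    with one more variable. Boundedness is carried along to settle the parameter 0. *)
Lemma hull_half_planes a0 (s : seq 'rV[R]_2) : exists L, [/\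
  forall a, a \in a0 :: s -> half_planes L a,
  exists M, forall y, half_planes L y -> forall k, `|y 0 k| <= M &
  forall A : set 'rV[R]_2, convex_set A -> (forall a, a \in a0 :: s -> A a) ->
    half_planes L `<=` A].
Proof.
elim: s => [|a s [L [sL [M hM] LA]]].
  pose e (k : 'I_2) : 'rV[R]_2 := \row_j (j == k)%:R.
  exists [:: (e 0, a0 0 0); (- e 0, - a0 0 0); (e 1, a0 0 1); (- e 1, - a0 0 1)].
  have K y : half_planes [:: (e 0, a0 0 0); (- e 0, - a0 0 0); (e 1, a0 0 1); (- e 1, - a0 0 1)] y <->
      y = a0.
    split=> [h|-> h].
      have := h (e 0, a0 0 0); have := h (- e 0, - a0 0 0).
      have := h (e 1, a0 0 1); have := h (- e 1, - a0 0 1).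
      rewrite !inE !eqxx !orbT /dot !mxE /= => /(_ isT) h1 /(_ isT) h2 /(_ isT) h3 /(_ isT) h4.
      by apply: row2P; apply/eqP; rewrite eq_le; apply/andP; split; lra.
    by rewrite !inE => /or4P[]/eqP->; rewrite /dot !mxE /=; lra.
  split=> [b|| A _ hA y /K->]; last by apply: hA; exact: mem_head.
    by rewrite inE => /eqP->; apply/K.
  by exists `|a0| => y /K-> k; exact: row_entry_norm.
have aA : half_planes L a0 by apply: sL; exact: mem_head.
(* With [y = (1 - t) *: a + t *: z], multiplying the constraints on [z] by [t] makes them linear in
   [y] and [t]; the first two entries encode [0 <= t <= 1]. *)
pose E : seq ('rV[R]_2 * R * R) :=
  [:: (0, 0, -1), (0, 1, 1) & [seq (h.1, dot h.1 a, dot h.1 a - h.2) | h <- L]].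
have EP y : half_planes (eliminate E) y <->
    exists t z, [/\ 0 <= t <= 1, half_planes L z & y = (1 - t) *: a + t *: z].
  have E0 : ((0 : 'rV[R]_2), (0 : R), (-1 : R)) \in E by rewrite inE eqxx.
  rewrite (fourier_motzkin y E0)/=; last by lra.
  split=> [[t ht]|[t [z [/andP[t0 t1] zL ->]]]].
    have t0 : 0 <= t by have := ht _ E0; rewrite /= dot0l; lra.
    have t1 : t <= 1.
      by have := ht (0, 1, 1); rewrite !inE eqxx orbT /= dot0l => /(_ isT); lra.
    have hL h : h \in L -> dot h.1 y + t * (dot h.1 a - h.2) <= dot h.1 a.
      move=> hL; apply: (ht (h.1, dot h.1 a, dot h.1 a - h.2)).
      by rewrite !inE; apply/orP; right; apply/orP; right; apply/mapP; exists h.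
    (* At [t = 0] the conditions say that [y - a] is a recession direction of a bounded nonempty
       set, whence [y = a]. *)
    have [t00|tn0] := eqVneq t 0.
      exists 0, a0; split=> //; first by rewrite lexx ler01.
      rewrite subr0 scale1r scale0r addr0; apply/eqP; rewrite -subr_eq0; apply/eqP.
      apply: (bounded_recession aA hM) => h /hL; rewrite t00 !dotE; lra.
    exists t, (a + t^-1 *: (y - a)); split; first by rewrite t0.
      move=> h /hL e; rewrite dotDr dotZr -(ler_pM2l (_ : 0 < t)) ?lt_def ?tn0//.
      by rewrite mulrDr mulVKf// !dotE; lra.
    rewrite scalerDr scalerA divff// scale1r addrA -scalerDl subrK scale1r.
    by rewrite addrC subrK.
  exists t => h; rewrite !inE => /or3P[/eqP->|/eqP->|/mapP[h' h'L ->]] /=.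
  - by rewrite dot0l; lra.
  - by rewrite dot0l; lra.
  - by have := zL h' h'L; rewrite !dotE; nra.
exists (eliminate E); split=> [b||A cA hA y /EP[t [z [/andP[t0 t1] zL ->]]]].
- move=> bs; apply/EP; have [->|ba] := eqVneq b a.
    by exists 0, a0; rewrite lexx ler01 subr0 scale1r scale0r addr0.
  exists 1, b; rewrite lexx ler01 subrr scale1r scale0r add0r; split=> //.
  by apply: sL; move: bs; rewrite !inE (negPf ba).
- exists (`|a| + M) => y /EP[t [z [/andP[t0 t1] zL ->]]] k.
  rewrite !mxE; apply: le_trans (ler_normD _ _) _; rewrite !normrM.
  have h1 : `|a 0 k| <= `|a| by exact: row_entry_norm.
  have h2 := hM z zL k.
  rewrite (ger0_norm t0) ger0_norm ?subr_ge0//.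
  by have := normr_ge0 (a 0 k); have := normr_ge0 (z 0 k); nra.
have Az : A z.
  apply: LA zL => // b bs; apply: hA; move: bs; rewrite !inE => /orP[->//|->].
  by rewrite !orbT.
have Aa : A a by apply: hA; rewrite !inE eqxx orbT.
by have := cA z a (Itv01 t0 t1); rewrite !inE addrC => /(_ Az Aa).
Qed.

End HalfPlanes.

(** If no point violates [w] and no other constraint, then [w] is implied by the others, and all its
    copies are removed; the length drops. *)
Lemma irredundant (R : realType) (U : seq 'rV[R]_2) : exists W : seq 'rV[R]_2,
  (forall y, (forall w, w \in W -> dot w y <= 1) <-> forall w, w \in U -> dot w y <= 1) /\
  forall w, w \in W -> exists2 y, 1 < dot w y &
    forall w', w' \in W -> w' != w -> dot w' y <= 1.
Proof.
have [n] := ubnP (size U); elim: n U => // n IH U Un.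
have [h|] := pselect (forall w, w \in U -> exists2 y, 1 < dot w y &
    forall w', w' \in U -> w' != w -> dot w' y <= 1); first by exists U.
move=> /existsNP[w /not_implyP[wU hw]].
have [|W [WU hW]] := IH [seq w' <- U | w' != w].
  apply: leq_trans (_ : size U <= n)%N => //.
  rewrite size_filter -(count_predC (pred1 w) U) -[X in (X < _)%N]add0n ltn_add2r.
  by rewrite -has_count has_pred1.
exists W; split=> // y; rewrite WU; split=> [h w' w'U|h w']; last first.
  by rewrite mem_filter => /andP[_]; exact: h.
have [w'w|w'w] := eqVneq w' w; last by apply: h; rewrite mem_filter w'w.
rewrite leNgt; apply/negP => yw; apply: hw; exists y; first by rewrite -w'w.
by move=> w'' w''U ne; apply: h; rewrite mem_filter ne.
Qed.

Lemma interior_direction (R : realType) (A : set 'rV[R]_2) p w : A° p ->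
  exists2 d, 0 < d & A (p + d *: w).
Proof.
move=> Ap.
have h : (p + t *: w) @[t --> nbhs (0 : R)] --> p.
  rewrite -[X in _ --> X]addr0 -[X in _ + X](scale0r w).
  apply: (@cvgD _ _ _ (nbhs (0 : R))); first exact: cvg_cst.
  by apply: (@cvgZ _ _ _ (nbhs (0 : R))); [exact: cvg_id|exact: cvg_cst].
have /nbhs_ballP[e /= e0 he] := h _ Ap.
exists (e / 2); first by rewrite divr_gt0.
by apply: he; rewrite /ball /= sub0r normrN gtr0_norm; lra.
Qed.

(** At an interior point [c] each half-plane with nonzero normal has positive slack, and dividing by
    it makes the bound 1; those with zero normal hold everywhere since they hold at [c]. *)
Lemma polygon_facets (R : realType) (C : set 'rV[R]_2) : convex_polygon C ->
  exists (I : finType) (u : I -> 'rV[R]_2) (c : 'rV[R]_2),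
  [/\ bounded_gauge u, irredundant_gauge u &
   C = [set y | forall m, dot (u m) (y - c) <= 1]].
Proof.
move=> [[V /finite_seqP[s ->] ->] [c cC]].
have [a0 [s' sE]] : exists a0 s', s = a0 :: s'.
  case: s cC => [|a0 s']; last by exists a0, s'.
  move=> /interior_subset cC; exfalso.
  have : set0 c by apply: cC; split=> // x y t; rewrite inE.
  by [].
have [L [sL [M hM] LA]] := hull_half_planes a0 s'.
have CE : convex_hull [set` s] = half_planes L.
  apply/seteqP; split.
    apply: smallest_sub; first exact: half_planes_convex.
    by move=> a /=; rewrite sE; exact: sL.
  move=> y yL A [/= cA sA]; apply: (LA A cA) => // a; rewrite -sE; exact: sA.
rewrite CE in cC *.
have cL : half_planes L c by exact: interior_subset cC.
pose slack (h : 'rV[R]_2 * R) := h.2 - dot h.1 c.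
have slack0 h : h \in L -> h.1 != 0 -> 0 < slack h.
  move=> hL h0; have [d d0 /(_ h hL)] := interior_direction h.1 cC.
  rewrite !dotE /slack.
  by have := dot_gt0 h0; nra.
pose U := [seq (slack h)^-1 *: h.1 | h <- L & h.1 != 0].
have UL y : (forall w, w \in U -> dot w y <= 1) <-> half_planes L (c + y).
  split=> [hU h hL|hL w /mapP[h]]; last first.
    rewrite mem_filter => /andP[h0 hL'] ->; have := hL h hL'.
    by rewrite dotZl ler_pdivrMl ?slack0// dotDr /slack mulr1; lra.
  have [h0|h0] := eqVneq h.1 0.
    by have := cL h hL; rewrite h0 !dot0l.
  have : (slack h)^-1 *: h.1 \in U by apply: map_f; rewrite mem_filter h0.
  by move=> /hU; rewrite dotZl ler_pdivrMl ?slack0// dotDr /slack mulr1; lra.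
have [W [WU hW]] := irredundant U.
exists (seq_sub W), val, c; split.
- exists (M + `|c|) => y hy k.
  have /hM/(_ k) : half_planes L (c + y).
    by apply/UL/WU => w wW; exact: (hy (SeqSub wW)).
  rewrite mxE => h; have := ler_normB (c 0 k + y 0 k) (c 0 k).
  by rewrite addrAC subrr add0r; have := row_entry_norm c k; lra.
- move=> m; have [y y1 hy] := hW (val m) (valP m).
  have y0 := lt_trans ltr01 y1.
  (* The point violating only this constraint is scaled back to its line, where the others become
     strict. *)
  exists ((dot (val m) y)^-1 *: y); first by rewrite dotZr mulVf ?gt_eqF.
  move=> k km; rewrite dotZr ltr_pdivrMl// mulr1.
  by apply: le_lt_trans y1; exact: (hy _ (valP k) km).
- apply/seteqP; split=> y /=.
    move=> yL m; have /WU : forall w, w \in U -> dot w (y - c) <= 1.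
      by apply/UL; rewrite addrC subrK.
    by move=> /(_ _ (valP m)).
  move=> hy; rewrite -(subrK c y) addrC; apply/UL/WU => w wW.
  exact: (hy (SeqSub wW)).
Qed.

(** * Transfer from the unit ball to the homothets of the polygon *)

Lemma closed_ball_set (R : realType) (I : finType) (u : I -> 'rV[R]_2) v l :
  closed [set y | in_ball u v l y].
Proof.
have -> : [set y | in_ball u v l y] =
    \bigcap_(m in [set: I]) (dot (u m) @^-1` [set x | x <= dot (u m) v + l]).
  apply/seteqP; split=> y /= h m => [_|]; have := h m; rewrite /= !dotE; first lra.
  by move=> /(_ Logic.I); lra.
apply: closed_bigI => m _.
by apply: preimage_closed; [move=> ? _; exact: dot_continuous|exact: closed_le].
Qed.

Lemma homothet_ball (R : realType) (I : finType) (u : I -> 'rV[R]_2) c v l : 0 < l ->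
  [set l *: x + v | x in [set y | in_ball u c 1 y]] = [set y | in_ball u (l *: c + v) l y].
Proof.
move=> l0; apply/seteqP; split=> [_ [x xC <-]|y hy] /=.
  by move=> m; have := xC m; rewrite !dotE; nra.
exists (l^-1 *: (y - v)); last by rewrite scalerA divff ?gt_eqF// scale1r subrK.
move=> m; have := hy m; rewrite /= !dotE => hm.
have e : l * (l^-1 * (dot (u m) y - dot (u m) v)) = dot (u m) y - dot (u m) v.
  by rewrite mulVKf ?gt_eqF.
by rewrite -(ler_pM2l l0) mulrBr e; lra.
Qed.

Lemma interior_ball (R : realType) (I : finType) (u : I -> 'rV[R]_2) :
  irredundant_gauge u ->
  forall v l p m, [set y | in_ball u v l y]° p -> dot (u m) (p - v) < l.
Proof.
move=> facet_u v l p m pint; have [z zm _] := facet_u m.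
have [d d0 /(_ m)] := interior_direction z pint; rewrite !dotE zm; lra.
Qed.

Theorem theorem3 (R : realType) (C : set 'rV[R]_2) (hC : convex_polygon C) :
  exists (c : R) (f : nat -> nat),
    self_coverability_function (homothets C) f /\
    forall k : nat, (1 <= k)%N -> (f k)%:R <= c * k%:R.
Proof.
have [I [u [c0 [bounded_u facet_u CE]]]] := polygon_facets hC.
have [N hN] := unit_ball_cover bounded_u facet_u.
(* The summand 1 covers the case where no point of [P] is interior to [S]; it is absorbed into
   [N.+1] because [k] is at least 1. *)
exists N.+1%:R, (fun k => N * k + 1)%N; split; last first.
  by move=> k k1; rewrite -natrM ler_nat mulSn addnC leq_add2r.
have hom l v : 0 < l -> [set l *: x + v | x in C] = [set y | in_ball u (l *: c0 + v) l y].
  by move=> l0; rewrite -homothet_ball// CE.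
split=> [S [l [v [l0 ->]]]|S P k [l [v [l0 ->]]] PS Pk].
  by rewrite hom//; exact: closed_ball_set.
have Pfin : finite_set P by exists k.
rewrite hom// in PS *; set s := l *: c0 + v in PS *.
pose nrm p := l^-1 *: (p - s).
have nrmE p m : l * dot (u m) (nrm p) = dot (u m) (p - s).
  by rewrite dotZr mulVKf ?gt_eqF.
(* Only points interior to [S] are passed on; a point on the boundary of [S] is interior to no ball
   contained in [S]. *)
pose Pr := [seq p <- [seq nrm p | p <- finmap.enum_fset (fset_set P)] |
  [forall m, dot (u m) p < 1]].
have sPr : (size Pr <= k)%N.
  rewrite size_filter; apply: leq_trans (count_size _ _) _.
  by rewrite size_map (card_fset_set Pk).
have [F [sF FP Fcover]] : exists F : seq ('rV[R]_2 * R), [/\ (size F <= N * k + 1)%N,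
    forall D, D \in F -> [/\ 0 < D.2, forall m, dot (u m) D.1 + D.2 <= 1 &
      forall p, p \in Pr -> exists m, D.2 <= dot (u m) (p - D.1)] &
    forall x, (forall m, dot (u m) x <= 1) -> exists2 D, D \in F & in_ball u D.1 D.2 x].
  have [Pr0|Pr0] := eqVneq Pr [::].
    exists [:: (0, 1)]; split=> [|D|x xC]; first by rewrite addn1.
      rewrite inE => /eqP-> /=; split=> // [m|p]; first by rewrite dot0r add0r.
      by rewrite Pr0.
    by exists (0, 1); rewrite ?mem_head// => m; rewrite subr0.
  have [|F [sF FP Fcover]] := hN Pr Pr0.
    by move=> p; rewrite mem_filter => /andP[/forallP].
  exists F; split=> //; apply: leq_trans sF _.
  by rewrite addn1 leqW// leq_mul2l sPr orbT.
pose B (D : 'rV[R]_2 * R) := [set y | in_ball u (s + l *: D.1) (l * D.2) y].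
have BE D y m : l * dot (u m) (nrm y - D.1) = dot (u m) (y - (s + l *: D.1)).
  by rewrite dotDr mulrDr nrmE !dotE; ring.
exists (B @` [set` F]); split.
- move=> _ [D DF <-]; have [D0 _ _] := FP D DF.
  have lD0 : 0 < l * D.2 by rewrite mulr_gt0.
  (* [C] is a ball centred at [c0], so the translation has to compensate for the scaled centre. *)
  exists (l * D.2), (s + l *: D.1 - (l * D.2) *: c0); split=> //.
  by rewrite hom// addrC subrK.
- apply: card_le_trans (card_image_le _ _) _.
  apply: (@card_le_trans _ _ _ [set nth (0, 0) F i | i in `I_(size F)]).
    apply: subset_card_le => D DF; exists (index D F); first by rewrite /= index_mem.
    by rewrite nth_index.
  apply: card_le_trans (card_image_le _ _) _; apply: subset_card_le => i /= iF.
  exact: leq_trans iF sF.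
- apply/seteqP; split=> [y [_ [D DF <-]]|y yS].
    have [_ Dwall _] := FP D DF; rewrite /B /= => yB m.
    by have := yB m; have := Dwall m; rewrite -BE -nrmE !dotE; nra.
  have [D DF yD] : exists2 D, D \in F & in_ball u D.1 D.2 (nrm y).
    by apply: Fcover => m; rewrite -(ler_pM2l l0) nrmE mulr1; exact: yS.
  by exists (B D); [exists D|move=> m; rewrite -BE ler_pM2l].
move=> p _ Pp [D DF <-] pint; have [_ Dwall Dsite] := FP D DF.
have [m hm] : exists m, D.2 <= dot (u m) (nrm p - D.1).
  have [pi|/forallPn[m]] := boolP [forall m, dot (u m) (nrm p) < 1].
    apply: Dsite; rewrite mem_filter pi/=; apply: map_f.
    by rewrite in_fset_set// inE.
  rewrite -leNgt; move: (nrm p) => x xm; exists m.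
  by have := Dwall m; rewrite !dotE; lra.
have := interior_ball facet_u m pint.
by rewrite -BE ltr_pM2l// ltNge hm.
Qed.
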